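(* Let $H_0:\mathbb{R}^{d_1}\to\mathbb{R}$ be $\rho$-strongly concave and $L$-smooth ($\rho,L>0$), let $H_1,\dots,H_m:\mathbb{R}^{d_1}\to\mathbb{R}$ be continuously differentiable and convex, $\mathcal X=\{x: H_i(x)\le0,\ i=1,\dots,m\}$, let $A\in\mathbb{R}^{d_2\times d_1}$, $b_0\in\mathbb{R}^{d_2}$, and suppose there exists $x$ with $H_i(x)<0$ for $i=1,\dots,m$ and $Ax=b_0$. Let $\{x_k,\lambda_k\}_{k\ge0}$ be generated by $$x_{k+1}=\mathcal{P}_{\mathcal X}\big(x_k+\alpha_k(\nabla H_0(x_k)-A^T\lambda_k+M_{k+1})\big),\qquad\lambda_{k+1}=\lambda_k+\beta_k(Ax_k-b_0),$$ with noise as in the context. Let $\epsilon\in(0,1/4)$ be arbitrary and let the step sizes be of order $\alpha_k\sim1/(k+1)^{0.5+0.66\epsilon}$, $\beta_k\sim1/(k+1)^{0.75+\epsilon}$, precisely as specified in the context. Then, almost surely, $\|x_k-\hat x(\lambda_k)\|\to0$ and $Ax_k\to b_0$, and $$\mathbb{E}\big[\|x_k-\hat x(\lambda_k)\|^2\big]\le\mathcal{O}\Big(\frac1{k^{0.5}}\Big),\qquad\mathbb{E}\big[\|Ax_k-b_0\|^2\big]\le\mathcal{O}\Big(\frac1{k^{0.25-\epsilon}}\Big).$$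
   Context: $\|\cdot\|$ is the Euclidean norm and $\mathcal{P}_{\mathcal X}$ the Euclidean projection onto $\mathcal X$. $L$-smooth means differentiable with $L$-Lipschitz gradient. For $\lambda\in\mathbb{R}^{d_2}$, $\hat x(\lambda)$ is the unique solution $x$ of $x=\mathcal{P}_{\mathcal X}\big(x+\nabla H_0(x)-A^T\lambda\big)$. The iteration is a Lagrangian method for maximizing $H_0(x)$ subject to $x\in\mathcal X$ and $Ax=b_0$. The initial points $x_0\in\mathbb{R}^{d_1}$, $\lambda_0\in\mathbb{R}^{d_2}$ are deterministic. Noise: with $\mathcal{F}_k=\sigma(x_0,\lambda_0,M_i,\ i\le k)$, $\mathbb{E}[M_{k+1}\mid\mathcal{F}_k]=0$ and, for some constant $\mathfrak{c}_2>0$, $\mathbb{E}[\|M_{k+1}\|^2\mid\mathcal{F}_k]\le\mathfrak{c}_2(1+\|x_k\|^2+\|\lambda_k\|^2)$ for all $k\ge0$. Step sizes: $\alpha_k=\alpha/(k+K_1)^{0.5+0.66\epsilon}$ and $\beta_k=\beta/(k+K_1)^{0.75+\epsilon}$ with constants $\alpha,\beta>0$ and $K_1\ge1$. *)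

(* Defs.v *)
From HB Require Import structures.
From mathcomp Require Export all_boot all_order all_algebra.
From mathcomp Require Export all_classical all_reals all_analysis.
From mathcomp Require Export measurable_realfun.
Export Order.TTheory GRing.Theory Num.Theory.
Export numFieldNormedType.Exports.

Set Implicit Arguments.
Unset Strict Implicit.
Unset Printing Implicit Defensive.

Local Open Scope classical_set_scope.
Local Open Scope ring_scope.

(* The library norm on matrices is the sup norm, hence this separate
   Euclidean norm (the two induce the same topology on R^n). *)
Definition enorm (R : realType) (n : nat) (v : 'cV[R]_n) : R :=
  Num.sqrt (\sum_i v i 0 ^+ 2).

Definition is_proj (R : realType) (n : nat) (X : set 'cV[R]_n)
    (y p : 'cV[R]_n) : Prop :=
  X p /\ forall z, X z -> enorm (y - p) <= enorm (y - z).

(* The nearest point exists and is unique when X is nonempty, closed and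
   convex; 0 is the junk value when there is no nearest point. *)
Definition proj (R : realType) (n : nat) (X : set 'cV[R]_n)
    (y : 'cV[R]_n) : 'cV[R]_n := xget 0 [set p | is_proj X y p].

(* Vector of partial derivatives; it represents the differential only
   at points where f is differentiable. *)
Definition grad (R : realType) (n : nat) (f : 'cV[R]_n -> R)
    (x : 'cV[R]_n) : 'cV[R]_n := \col_i 'D_(delta_mx i 0) f x.

Definition strongly_concave (R : realType) (n : nat) (rho : R)
    (f : 'cV[R]_n -> R) : Prop :=
  forall (x y : 'cV[R]_n) (t : R), 0 <= t <= 1 ->
    t * f x + (1 - t) * f y + rho / 2 * t * (1 - t) * enorm (x - y) ^+ 2
      <= f (t *: x + (1 - t) *: y).

Definition smooth (R : realType) (n : nat) (L : R)
    (f : 'cV[R]_n -> R) : Prop :=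
  (forall x, differentiable f x) /\
  (forall x y, enorm (grad f x - grad f y) <= L * enorm (x - y)).

Definition continuously_differentiable (R : realType) (n : nat)
    (f : 'cV[R]_n -> R) : Prop :=
  (forall x, differentiable f x) /\ continuous (grad f).

Definition sublevel (R : realType) (n m : nat)
    (H : 'I_m -> 'cV[R]_n -> R) : set 'cV[R]_n :=
  [set x | forall i, H i x <= 0].

(* For X nonempty closed convex and H0 strongly concave and smooth the
   fixed point exists and is unique, so the choice made by xget is forced. *)
Definition xhat (R : realType) (d1 d2 : nat) (X : set 'cV[R]_d1)
    (H0 : 'cV[R]_d1 -> R) (A : 'M[R]_(d2, d1)) (lambda : 'cV[R]_d2)
    : 'cV[R]_d1 :=
  xget 0 [set x | x = proj X (x + grad H0 x - A^T *m lambda)].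

(* Y is a version of E[X | G], for X integrable or nonnegative. *)
Definition is_cond_exp (R : realType) (d : measure_display)
    (T : measurableType d) (P : probability T R) (G : set (set T))
    (X Y : T -> \bar R) : Prop :=
  [/\ P.-integrable [set: T] X \/
        (measurable_fun [set: T] X /\ forall w, (0 <= X w)%E),
      forall B : set (\bar R), measurable B -> G (Y @^-1` B) &
      forall E, G E -> (\int[P]_(w in E) Y w = \int[P]_(w in E) X w)%E].

(* sigma(M_1, ..., M_k).  Deterministic initial points generate only the
   trivial sigma-algebra, so they are left out.  The noise is indexed from 1:
   the value M 0 is never used. *)
Definition noise_sigma (R : realType) (d : measure_display)
    (T : measurableType d) (n : nat) (M : nat -> T -> 'cV[R]_n) (k : nat)
    : set (set T) :=
  <<s [set E | exists i j (B : set R), [/\ (1 <= i <= k)%N, measurable B &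
         E = (fun w => M i w j 0) @^-1` B]] >>.

Definition martingale_noise (R : realType) (d : measure_display)
    (T : measurableType d) (P : probability T R) (d1 d2 : nat) (c2 : R)
    (M : nat -> T -> 'cV[R]_d1) (x : nat -> T -> 'cV[R]_d1)
    (lambda : nat -> T -> 'cV[R]_d2) : Prop :=
  forall k : nat,
  [/\ forall j, measurable_fun [set: T] (fun w => M k.+1 w j 0),
      forall j, is_cond_exp P (noise_sigma M k)
                  (fun w => (M k.+1 w j 0)%:E) (cst 0%E) &
      exists V : T -> \bar R,
        is_cond_exp P (noise_sigma M k)
          (fun w => (enorm (M k.+1 w) ^+ 2)%:E) V /\
        {ae P, forall w,
          (V w <= (c2 * (1 + enorm (x k w) ^+ 2
                           + enorm (lambda k w) ^+ 2))%:E)%E}].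

(* Main.v *)
(** For a multiplier [l] the strongly concave Lagrangian has a unique maximizer
    [xh l] over [X], which is Lipschitz in [l]; the dual function [D] is convex and
    smooth with gradient [- (A xh(l) - b0)], and Slater's condition makes it coercive
    in [A^T l], so that it has a minimizer [ls].  With [e = |x - xh l|^2],
    [w = 1 + e + |l - ls|^2] and step sizes [al], [be] such that
    [be^2 = O(al^3)], one step of the method gives, up to constants,
      [E e'       <= (1 - rho al) e + al^2 w],
      [|l' - ls|^2 <= |l - ls|^2 + al e + al^2 w],
      [D(l')      <= D(l) - be / 2 |A xh(l) - b0|^2 + be e + be^2 w].
    Since [al^2] is summable, the first two bound the second moments, and then
    [E e = O(k^(-1/2))].  Convexity bounds [|A xh(l) - b0|^2] below by
    [2 t (D(l) - min D) - t^2 |l - ls|^2] for every [t > 0]; with [t] of order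
    [k^(-(1/4 - eps))] the third inequality yields the rate of [D(l) - min D],
    which controls [|A xh(l) - b0|^2].
    Finally [D(l) - min D + c e + U_k (1 + b e + |l - ls|^2)], for suitable [c], [b]
    and deterministic [U_k -> 0], is a nonnegative supermartingale whose mean
    tends to 0, so the maximal inequality makes it converge to 0 almost surely. *)

Require Import Defs.
From mathcomp Require Import ring lra.

Set Implicit Arguments.
Unset Strict Implicit.
Unset Printing Implicit Defensive.

Import HBNNSimple.

Local Open Scope classical_set_scope.
Local Open Scope ring_scope.

(** * Euclidean geometry of column vectors *)

(** Conditional inequalities are stated as inequalities between integrals over an arbitrary [E] in
    the sigma-algebra of the past: [E = setT] gives the moment bounds, general [E] the
    supermartingale property. The iterates are not assumed bounded and the noise variance may grow
    with them, which is why the remainders carry the weight w. [A] need not have full row rank, so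
    the dual is in general not strongly convex and |l - ls|^2 does not contract; the rate has to
    come from the dual gap. The target xh(l) moves at each step by a multiple of be. Separating this
    motion with a Young weight of order al costs be^2 / al, which be^2 = O(al^3) turns into O(al^2).
    The choice t = 1 / (be k) makes the dual inequality a contraction at rate 1/k. *)

Definition dot (R : realType) (n : nat) (u v : 'cV[R]_n) : R :=
  \sum_i u i 0 * v i 0.

Section Dot.
Context {R : realType} {n : nat}.
Implicit Types (u v w : 'cV[R]_n) (a s : R).

Lemma dotC u v : dot u v = dot v u.
Proof. by apply: eq_bigr => i _; rewrite mulrC. Qed.

Lemma dotDl u v w : dot (u + v) w = dot u w + dot v w.
Proof. by rewrite -big_split; apply: eq_bigr => i _; rewrite mxE mulrDl. Qed.

Lemma dotZl a u w : dot (a *: u) w = a * dot u w.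
Proof. by rewrite mulr_sumr; apply: eq_bigr => i _; rewrite mxE mulrA. Qed.

Lemma dotNl u w : dot (- u) w = - dot u w.
Proof. by rewrite -scaleN1r dotZl mulN1r. Qed.

Lemma dotDr u v w : dot w (u + v) = dot w u + dot w v.
Proof. by rewrite !(dotC w) dotDl. Qed.

Lemma dotZr a u w : dot w (a *: u) = a * dot w u.
Proof. by rewrite !(dotC w) dotZl. Qed.

Lemma dotNr u w : dot w (- u) = - dot w u.
Proof. by rewrite !(dotC w) dotNl. Qed.

Definition dotE := (dotDl, dotDr, dotNl, dotNr, dotZl, dotZr).

Lemma dot0r u : dot u 0 = 0.
Proof. by rewrite -(scale0r 0) dotZr mul0r. Qed.

Lemma dot_ge0 v : 0 <= dot v v.
Proof. by apply: sumr_ge0 => i _; exact: sqr_ge0. Qed.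

Lemma dot_coord v i : v i 0 ^+ 2 <= dot v v.
Proof.
rewrite /dot (bigD1 i)//= -expr2 lerDl.
by apply: sumr_ge0 => j _; exact: sqr_ge0.
Qed.

Lemma dot_eq0 v : dot v v = 0 -> v = 0.
Proof.
move=> v0; apply/colP => i; rewrite mxE; apply/eqP; rewrite -sqrf_eq0.
by rewrite eq_le sqr_ge0 andbT -v0 dot_coord.
Qed.

Lemma enorm_ge0 v : 0 <= enorm v.
Proof. exact: sqrtr_ge0. Qed.

Lemma enorm_sq v : enorm v ^+ 2 = dot v v.
Proof.
rewrite /enorm sqr_sqrtr; last by apply: sumr_ge0 => i _; exact: sqr_ge0.
by apply: eq_bigr => i _; rewrite expr2.
Qed.

Lemma dot_young s u v : 0 < s -> 2 * dot u v <= s * dot u u + s^-1 * dot v v.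
Proof.
move=> s0; have := dot_ge0 (s *: u - v); rewrite !dotE (dotC v u) => h.
have : 0 <= s^-1 * (s * (s * dot u u) - s * dot u v + - (s * dot u v - dot v v)).
  by apply: mulr_ge0; [rewrite invr_ge0 ltW | lra].
have -> : s^-1 * (s * (s * dot u u) - s * dot u v + - (s * dot u v - dot v v))
  = s * dot u u - 2 * dot u v + s^-1 * dot v v by field; lra.
lra.
Qed.

Lemma dot_CS u v : dot u v ^+ 2 <= dot u u * dot v v.
Proof.
have [/dot_eq0 ->|v0] := eqVneq (dot v v) 0.
  by rewrite !dot0r mulr0 expr0n.
have {}v0 : 0 < dot v v by rewrite lt_neqAle eq_sym v0 dot_ge0.
have := dot_ge0 (dot v v *: u - dot u v *: v); rewrite !dotE (dotC v u) => h.
rewrite -subr_ge0 -(pmulr_rge0 _ v0); lra.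
Qed.

Lemma dotD_le u v : dot (u + v) (u + v) <= 2 * dot u u + 2 * dot v v.
Proof. have := dot_ge0 (u - v); rewrite !dotE (dotC v u); lra. Qed.

Lemma dotD_young s u v : 0 < s ->
  dot (u + v) (u + v) <= (1 + s) * dot u u + (1 + s^-1) * dot v v.
Proof. move=> /(dot_young u v); rewrite !dotE (dotC v u); lra. Qed.

(** The crude bound [1 + c] avoids a square root; it serves only to show that a set is bounded. *)
Lemma norm_le_dot v c : 0 <= c -> dot v v <= c -> `|v| <= 1 + c.
Proof.
move=> c0 vc; rewrite [leLHS]/Num.norm /= mx_normrE.
apply/bigmax_leP; split; first lra.
move=> [i j] _ /=; rewrite ord1.
have := dot_coord v i; rewrite -real_normK ?num_real// => h.
have := normr_ge0 (v i 0); nra.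
Qed.

Lemma norm_lt_dot v e : 0 < e -> dot v v < e ^+ 2 -> `|v| < e.
Proof.
move=> e0 ve; rewrite [ltLHS]/Num.norm /= mx_normrE.
apply/bigmax_ltP; split=> // -[i j] _ /=; rewrite ord1.
rewrite -(ltr_pXn2r (n := 2))// ?nnegrE ?(ltW e0)// real_normK ?num_real//.
exact: le_lt_trans (dot_coord v i) ve.
Qed.

End Dot.

Lemma dot_mul (R : realType) n p (A : 'M[R]_(p, n)) u v :
  dot (A *m u) v = dot u (A^T *m v).
Proof.
rewrite /dot; under eq_bigr do rewrite mxE mulr_suml.
rewrite exchange_big; apply: eq_bigr => i _; rewrite mxE mulr_sumr.
by apply: eq_bigr => j _; rewrite mxE mulrCA mulrA.
Qed.

(** Cauchy-Schwarz row by row. The constant is the squared Frobenius norm, plus 1 to be positive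
    even for [A = 0]. *)
Lemma dot_mul_bound (R : realType) n p (A : 'M[R]_(p, n)) :
  exists2 c, 0 < c & forall u, dot (A *m u) (A *m u) <= c * dot u u.
Proof.
exists (1 + \sum_i dot (row i A)^T (row i A)^T).
  by rewrite ltr_pwDl// sumr_ge0// => i _; exact: dot_ge0.
move=> u; rewrite mulrDl mul1r mulr_suml ler_wpDl ?dot_ge0//.
apply: ler_sum => i _; rewrite -expr2.
suff -> : (A *m u) i 0 = dot (row i A)^T u by exact: dot_CS.
by rewrite mxE; apply: eq_bigr => j _; rewrite !mxE.
Qed.

Section ColumnTopology.
Context {R : realType}.

Lemma trmx_continuous m n : continuous (fun u : 'M[R]_(m, n) => u^T).
Proof.
move=> u B [P HP sub]; exists (fun i j => P j i) => [i j|v Pv].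
  by have := HP j i; rewrite mxE.
by apply: sub => i j; rewrite mxE.
Qed.

Lemma dot_continuous n : continuous (fun u : 'cV[R]_n => dot u u).
Proof.
apply: (@continuous_big R^o _ +%R 0 xpredT add_continuous) => i _ u.
by apply: (@cvgM _ _ (nbhs u) _ (fun v => v i 0) (fun v => v i 0)); exact: (@coord_continuous R).
Qed.

(** The search is restricted to the superlevel set of [f] at [z], which the last hypothesis bounds.
    The extreme value theorem [EVT_max_rV] speaks of row vectors, hence the transposes. *)
Lemma cV_argmax n (f : 'cV[R]_n -> R) (X : set 'cV[R]_n) z r :
  X z -> closed X -> continuous f ->
  (forall x, X x -> f z <= f x -> dot (x - z) (x - z) <= r) ->
  exists2 p, X p & forall x, X x -> f x <= f p.
Proof.
move=> Xz clX cf bnd.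
have r0 : 0 <= r by rewrite (le_trans (dot_ge0 _) (bnd z Xz (lexx _))).
pose Y := [set x | X x /\ f z <= f x].
have clY : closed Y.
  apply: closedI => //; apply: (preimage_closed _ (@closed_ge _ _)) => x _.
  exact: cf.
pose Z := [set u : 'rV[R]_n | Y u^T].
have clZ : closed Z.
  apply: (@preimage_closed _ _ (fun u : 'rV[R]_n => u^T) Y) => // u _.
  exact: trmx_continuous.
have Zz : Z !=set0 by exists z^T; rewrite /Z/= trmxK; split.
have bZ : bounded_set Z.
  exists (`|z| + (1 + r)); split=> [|b /ltW zrb u [Xu fu]]; first exact: num_real.
  apply: (le_trans _ zrb).
  have -> : `|u| = `|u^T|.
    rewrite /Num.norm/= !mx_normrE; apply/le_anti/andP; split.
      apply/bigmax_leP; split; first exact: bigmax_ge_id.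
      move=> [i j] _ /=; apply/bigmax_geP; right.
      by exists (j, i) => //=; rewrite mxE.
    apply/bigmax_leP; split; first exact: bigmax_ge_id.
    move=> [i j] _ /=; apply/bigmax_geP; right.
    by exists (j, i) => //=; rewrite mxE.
  rewrite -{1}[u^T](subrK z) addrC (le_trans (ler_normD _ _))// lerD2l.
  by apply: norm_le_dot => //; exact: bnd.
have cZ := bounded_closed_compact bZ clZ : compact Z.
have cfZ : {within Z, continuous (fun u => f u^T)}.
  apply: continuous_subspaceT => u.
  by apply: continuous_comp; [exact: trmx_continuous | exact: cf].
have [p /set_mem[Xp fp] pmax] := EVT_max_rV Zz cZ cfZ.
exists p^T => // x Xx; have [fx|/ltW fx] := leP (f z) (f x).
  by have := pmax x^T; rewrite trmxK; apply; rewrite inE /Z/= trmxK.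
exact: le_trans fx fp.
Qed.

End ColumnTopology.

(** * Strongly concave maximization *)

Local Notation sq u := (dot u u).

Section Concave.
Context {R : realType} {n : nat}.
Implicit Types (X : set 'cV[R]_n) (f : 'cV[R]_n -> R) (G : 'cV[R]_n -> 'cV[R]_n).
Implicit Types (rho L : R).

Definition convex_cV X := forall x y t,
  X x -> X y -> 0 <= t <= 1 -> X (x + t *: (y - x)).

(** First-order strong concavity with an arbitrary field [G], so that it applies to the Lagrangian
    and to minus half the squared distance without computing their gradients. *)
Definition supergradient rho f G :=
  forall x y, f y <= f x + dot (G x) (y - x) - rho / 2 * sq (y - x).

Definition lipschitz_sq L G := forall x y, sq (G x - G y) <= L * sq (x - y).

Lemma derive_dot_grad f x v : differentiable f x -> 'D_v f x = dot (grad f x) v.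
Proof.
move=> df; rewrite deriveE//.
rewrite [v in LHS](_ : _ = \sum_i v i 0 *: delta_mx i 0); last first.
  by rewrite {1}[v]matrix_sum_delta; apply: eq_bigr => i _; rewrite big_ord1.
rewrite linear_sum; apply: eq_bigr => i _.
by rewrite linearZ mxE deriveE// mulrC.
Qed.

(** Divide strong concavity on the segment from [x] to [y] by the weight [h] of [y] and let [h] tend
    to 0 from the right. *)
Lemma supergradient_grad rho f : (forall x, differentiable f x) ->
  strongly_concave rho f -> supergradient rho f (grad f).
Proof.
move=> df scf x y.
rewrite -derive_dot_grad//.
have dfx : (fun h => h^-1 *: (f (h *: (y - x) + x) - f x)) @ 0^'+
    --> 'D_(y - x) f x.
  by apply: cvg_dnbhs_at_right; exact: diff_derivable.
have lfx : (fun h => f y - f x + rho / 2 * sq (y - x) * (1 - h)) @ 0^'+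
    --> f y - f x + rho / 2 * sq (y - x) * (1 - 0).
  apply: cvg_at_right_filter; apply: cvgD; first exact: cvg_cst.
  apply: cvgM; first exact: cvg_cst.
  by apply: cvgB; [exact: cvg_cst | exact: cvg_id].
suff : f y - f x + rho / 2 * sq (y - x) * (1 - 0) <= 'D_(y - x) f x by lra.
apply: (ler_cvg_to lfx dfx); near=> h.
have h0 : 0 < h by near: h; exact: nbhs_right_gt.
have h1 : h < 1 by near: h; exact: nbhs_right_lt.
have h01 : 0 <= h <= 1 by rewrite !ltW.
have := scf y x h h01; rewrite enorm_sq.
rewrite (_ : h *: y + (1 - h) *: x = h *: (y - x) + x); last first.
  by rewrite scalerBl scalerBr scale1r addrA [RHS]addrAC.
move=> hf; rewrite -(ler_pM2l h0) [leRHS]mulrA divff ?gt_eqF// mul1r.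
lra.
Unshelve. all: by end_near. Qed.

Variables (rho L : R) (f : 'cV[R]_n -> R) (G : 'cV[R]_n -> 'cV[R]_n).
Hypotheses (rho0 : 0 < rho) (sG : supergradient rho f G).

Lemma supergradient_mono x y : dot (G x - G y) (x - y) <= - rho * sq (x - y).
Proof.
have := sG x y; have := sG y x.
by rewrite -(opprB x y) !dotE; lra.
Qed.

Variable X : set 'cV[R]_n.
Hypotheses (cX : convex_cV X).

Lemma concave_argmax z : X z -> closed X -> continuous f ->
  exists2 p, X p & forall x, X x -> f x <= f p.
Proof.
(* If [f z <= f x], then [rho / 2 * sq (x - z)] is at most [dot (G z) (x - z)]; a Young inequality
   of weight [2 / rho] absorbs half of it and leaves this radius. *)
move=> Xz clX cf; apply: (cV_argmax (r := 4 / rho ^+ 2 * sq (G z)) Xz clX cf).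
move=> x Xx fzx; have := sG z x.
have r2 : 0 < 2 / rho by rewrite divr_gt0.
have := dot_young (G z) (x - z) r2; rewrite invf_div => yg sg.
have h : rho / 4 * sq (x - z) <= sq (G z) / rho by lra.
have r4 : 0 < rho / 4 by rewrite divr_gt0.
rewrite -(ler_pM2l r4).
apply: (le_trans h); rewrite le_eqVlt; apply/orP; left; apply/eqP; field.
by rewrite gt_eqF.
Qed.

(** [G] is not known to be a derivative, so the inequality is first obtained at points [q] of the
    segment towards [y], from the supergradient inequality at [q] and [f q <= f p]. The Lipschitz
    bound carries it to [p] with an error linear in [t], and [t] is arbitrarily small. *)
Lemma argmax_VI p : 0 <= L -> lipschitz_sq L G -> X p ->
  (forall x, X x -> f x <= f p) -> forall y, X y -> dot (G p) (y - p) <= 0.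
Proof.
move=> L0 lG Xp pmax y Xy.
set c := (1 + L) / 2 * sq (y - p).
have c0 : 0 <= c by rewrite mulr_ge0 ?dot_ge0//; lra.
have key t : 0 < t -> t <= 1 -> dot (G p) (y - p) <= t * c.
  move=> t0 t1; set q := p + t *: (y - p).
  have Xq : X q by apply: cX => //; lra.
  have qp : q - p = t *: (y - p) by rewrite /q addrC addKr.
  have pq : p - q = - (t *: (y - p)) by rewrite -qp opprB.
  have h3 : dot (G q) (y - p) <= 0.
    rewrite -(pmulr_rle0 _ t0).
    have : 0 <= rho / 2 * (t * (t * sq (y - p))).
      by rewrite !mulr_ge0 ?dot_ge0 ?invr_ge0// ltW.
    have := sG q p; have := pmax q Xq.
    by rewrite pq !(dotNl, dotNr, dotZl, dotZr); lra.
  have h4 : t^-1 * sq (G p - G q) <= L * t * sq (y - p).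
    have := lG p q; rewrite pq !(dotNl, dotNr, dotZl, dotZr) => h4.
    by rewrite mulrC ler_pdivrMr//; lra.
  have := dot_young (y - p) (G p - G q) t0.
  have -> : dot (y - p) (G p - G q) = dot (G p) (y - p) - dot (G q) (y - p).
    by rewrite dotC dotDl dotNl.
  rewrite /c; lra.
rewrite leNgt; apply/negP => d0.
set d := dot (G p) (y - p) in key d0.
(* Small enough that [t * c] stays below [d], contradicting [key]. *)
pose t := Num.min 1 (d / (2 * (1 + c))).
have t0 : 0 < t.
  by rewrite lt_min ltr01/= divr_gt0// mulr_gt0//; lra.
have t1 : t <= 1 by rewrite ge_min lexx.
have td : t * (2 * (1 + c)) <= d.
  by rewrite -ler_pdivlMr ?ge_min ?lexx ?orbT// mulr_gt0//; lra.
have := key t t0 t1; nra.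
Qed.

Lemma VI_quad p x : X x -> (forall y, X y -> dot (G p) (y - p) <= 0) ->
  f x <= f p - rho / 2 * sq (x - p).
Proof. by move=> Xx /(_ x Xx); have := sG p x; lra. Qed.

End Concave.

(** * Projection onto a closed convex set *)

Section Projection.
Context {R : realType} {n : nat} (X : set 'cV[R]_n).
Hypotheses (cX : convex_cV X) (clX : closed X) (X0 : X !=set0).

Lemma enorm_le (u v : 'cV[R]_n) : (enorm u <= enorm v) = (sq u <= sq v).
Proof. by rewrite -!enorm_sq ler_pXn2r// nnegrE enorm_ge0. Qed.

(** Its maximizers over [X] are the nearest points to [y], and it is 1-strongly concave, so
    existence and the variational inequality follow from the results on concave maximization. *)
Let hd (y x : 'cV[R]_n) : R := - (1 / 2) * sq (x - y).

Let hd_super y : supergradient 1 (hd y) (fun x => y - x).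
Proof.
move=> a b; rewrite /hd !dotE (dotC y a) (dotC y b) (dotC b a).
by rewrite le_eqVlt; apply/orP; left; apply/eqP; field.
Qed.

Let hd_lip (y : 'cV[R]_n) : lipschitz_sq 1 (fun x => y - x).
Proof.
move=> a b; have -> : y - a - (y - b) = - (a - b).
  by apply/colP => i; rewrite !mxE; ring.
by rewrite dotNl dotNr opprK mul1r.
Qed.

Let hd_continuous y : continuous (hd y).
Proof.
move=> x; apply: (@cvgM _ _ (nbhs x) _ (fun=> _) (fun x => sq (x - y))).
  exact: cvg_cst.
apply: (cvg_comp (fun x => x - y) (fun u => sq u)); last exact: dot_continuous.
by apply: cvgB; [exact: cvg_id | exact: cvg_cst].
Qed.

Let is_proj_max y p : is_proj X y p <-> X p /\ forall z, X z -> hd y z <= hd y p.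
Proof.
have E z : sq (y - z) = sq (z - y) by rewrite -(opprB z y) dotNl dotNr opprK.
split=> -[Xp pm]; split=> // z /pm; rewrite /hd enorm_le !E; lra.
Qed.

Lemma proj_is_proj y : is_proj X y (proj X y).
Proof.
have [z Xz] := X0; rewrite /proj; apply: xgetPex.
have [p Xp pm] := concave_argmax (ltr01 : 0 < (1 : R)) (@hd_super y) Xz clX (@hd_continuous y).
by exists p; apply/is_proj_max.
Qed.

Lemma proj_in y : X (proj X y).
Proof. by have [] := proj_is_proj y. Qed.

Lemma proj_VI y z : X z -> dot (y - proj X y) (z - proj X y) <= 0.
Proof.
move=> Xz; have /is_proj_max[Xp pm] := proj_is_proj y.
exact: (argmax_VI (ltr01 : 0 < (1 : R)) (@hd_super y) cX ler01 (@hd_lip y) Xp pm).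
Qed.

(** The inequalities for [p] and for the projection [q], each tested at the other point, add up to
    [sq (q - p) <= 0]. *)
Lemma proj_unique y p : X p -> (forall z, X z -> dot (y - p) (z - p) <= 0) ->
  p = proj X y.
Proof.
move=> Xp VI; apply/eqP; rewrite -subr_eq0; apply/eqP/dot_eq0/le_anti.
rewrite dot_ge0 andbT.
have := VI _ (proj_in y); have := proj_VI y Xp.
set q := proj X y; rewrite -(opprB q p); set u := q - p.
have -> : y - q = (y - p) - u by apply/colP => i; rewrite /u !mxE; ring.
by clearbody u; rewrite !(dotDl _ (- u)) !dotNl !dotNr; lra.
Qed.

Lemma proj_nonexpansive y y' :
  sq (proj X y - proj X y') <= sq (y - y').
Proof.
have := proj_VI y (proj_in y'); have := proj_VI y' (proj_in y).
set p := proj X y; set p' := proj X y'; rewrite -(opprB p p'); set u := p - p'.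
have -> : y' - p' = y' - y + (y - p) + u.
  by apply/colP => i; rewrite /u !mxE; ring.
set v := y - p; rewrite -(opprB y y'); set w := y - y'.
clearbody u v w; rewrite !dotE => h1 h2.
have := dot_young w u (ltr01 : 0 < (1 : R)); rewrite invr1; lra.
Qed.

End Projection.

Section Sublevel.
Context {R : realType} {n m : nat} (H : 'I_m -> 'cV[R]_n -> R).

Lemma closed_sublevel : (forall i, continuous (H i)) -> closed (sublevel H).
Proof.
move=> cH; rewrite (_ : sublevel H = \bigcap_i [set x | H i x <= 0]).
  apply: closed_bigI => i _; apply: (preimage_closed _ (@closed_le _ _)) => x _.
  exact: cH.
by apply/seteqP; split=> x hx i; [move=> _; exact: hx | exact: (hx i I)].
Qed.

Lemma convex_sublevel : (forall i, convex_function setT (H i)) ->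
  convex_cV (sublevel H).
Proof.
move=> cH x y t Hx Hy t01 i.
have t01' : Itv.spec (@Itv.num_sem R) (Itv.Real `[0%Z, 1%Z]) t.
  by rewrite /Itv.spec/= /Itv.num_sem/= num_real/= in_itv/=.
(* The weight [t] goes to the first point, hence the order [y], [x]. *)
have := cH i (Itv.mk t01') y x (in_setT _) (in_setT _).
have -> : conv (Itv.mk t01') (y : convex_lmodType _) x = x + t *: (y - x).
  by rewrite /conv/=; apply/colP => k; rewrite !mxE ?/unstable.onem; ring.
move=> /le_trans; apply.
move: (Hx i) (Hy i) => Hxi Hyi.
change (t * H i y + (1 - t) * H i x <= 0); nra.
Qed.

Lemma sublevel_interior z : (forall i, continuous (H i)) ->
  (forall i, H i z < 0) ->
  exists2 d, 0 < d & forall x, sq (x - z) <= d ^+ 2 -> sublevel H x.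
Proof.
move=> cH Hz.
have : \forall x \near z, forall i, H i x < 0.
  apply: (@filter_forall _ _ (fun i x => H i x < 0) (nbhs z)) => i.
  exact: (cvgr_lt (H i z) (cH i z) 0 (Hz i)).
(* Halving makes the closed Euclidean ball fit into the open sup-norm ball of radius [e]. *)
move=> /nbhs_ballP[e /= e0 He]; exists (e / 2); first by rewrite divr_gt0.
move=> x xz i; apply/ltW/He; split=> // k j; rewrite ord1.
have := dot_coord (x - z) k; rewrite !mxE => h.
rewrite /ball/= distrC -(ltr_pXn2r (n := 2%N))// ?nnegrE ?ltW// real_normK ?num_real//.
nra.
Qed.

End Sublevel.

(** * The dual function *)

Lemma dot_continuous_r (R : realType) n (u : 'cV[R]_n) : continuous (fun v => dot u v).
Proof.
apply: (@continuous_big R^o _ +%R 0 xpredT add_continuous) => i _ v.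
apply: (@cvgM _ _ (nbhs v) _ (fun=> _) (fun v => v i 0)); first exact: cvg_cst.
exact: (@coord_continuous R).
Qed.

Lemma dot_mulA (R : realType) n p (A : 'M[R]_(n, p)) (l : 'cV[R]_n) x :
  dot l (A *m x) = dot (A^T *m l) x.
Proof. by rewrite dotC dot_mul dotC. Qed.

Section Lagrangian.
Context {R : realType} {d1 d2 : nat} (rho : R) (H0 : 'cV[R]_d1 -> R).
Variables (A : 'M[R]_(d2, d1)) (b0 : 'cV[R]_d2).

Definition lagrangian (l : 'cV[R]_d2) x := H0 x - dot l (A *m x - b0).

Local Notation drift l x := (grad H0 x - A^T *m l).

Lemma lagrangian_super l : supergradient rho H0 (grad H0) ->
  supergradient rho (lagrangian l) (fun x => drift l x).
Proof.
move=> sH x y; have := sH x y; rewrite /lagrangian.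
rewrite (dotDl (grad H0 x)) (dotNl (_ *m _)) -dot_mulA mulmxBr.
by rewrite !(dotDr _ _ l) !(dotNr _ l); lra.
Qed.

Lemma lagrangian_continuous l : continuous H0 -> continuous (lagrangian l).
Proof.
have E : lagrangian l = H0 - (dot (A^T *m l) - cst (dot l b0)).
  by apply/funext => x; rewrite !fctE /lagrangian dotDr dotNr dot_mulA.
rewrite E => cH x; apply: continuousB; first exact: cH.
by apply: continuousB; [exact: dot_continuous_r | exact: cst_continuous].
Qed.

End Lagrangian.

Section Xhat.
Context {R : realType} {d1 d2 : nat} (rho L : R) (X : set 'cV[R]_d1).
Variables (H0 : 'cV[R]_d1 -> R) (A : 'M[R]_(d2, d1)).
Hypotheses (rho0 : 0 < rho) (sH : supergradient rho H0 (grad H0)).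
Hypotheses (L0 : 0 <= L) (cX : convex_cV X) (clX : closed X) (X0 : X !=set0).
Hypotheses (lH : lipschitz_sq L (grad H0)) (cH : continuous H0).

Local Notation xh := (xhat X H0 A).
Local Notation drift l x := (grad H0 x - A^T *m l).

Let lagrangian_lip l : lipschitz_sq L (fun x => drift l x).
Proof.
move=> x y.
have -> : grad H0 x - A^T *m l - (grad H0 y - A^T *m l) = grad H0 x - grad H0 y.
  by apply/colP => i; rewrite !mxE; ring.
exact: lH.
Qed.

(** A maximizer of the Lagrangian satisfies the variational inequality that characterizes this
    projection, so a fixed point exists and [xget] returns one. The vector [b0] only adds a constant
    in [x] and is taken to be 0. *)
Lemma xhat_fixpoint l : xh l = proj X (xh l + grad H0 (xh l) - A^T *m l).
Proof.
rewrite /xhat; apply: (@xgetPex _ 0 [set x | x = proj X (x + grad H0 x - A^T *m l)]).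
have [z Xz] := X0.
have [p Xp pm] := concave_argmax rho0 (lagrangian_super A 0 l sH) Xz clX
  (@lagrangian_continuous _ _ _ H0 A 0 l cH).
exists p => /=; apply: proj_unique => // y Xy.
have := argmax_VI rho0 (lagrangian_super A 0 l sH) cX L0 (@lagrangian_lip l) Xp pm Xy.
suff -> : p + grad H0 p - A^T *m l - p = drift l p by [].
by apply/colP => i; rewrite !mxE; ring.
Qed.

Lemma xhat_in l : X (xh l).
Proof. by rewrite xhat_fixpoint; exact: proj_in. Qed.

Lemma xhat_VI l y : X y -> dot (grad H0 (xh l) - A^T *m l) (y - xh l) <= 0.
Proof.
move=> /(proj_VI cX clX X0 (xh l + grad H0 (xh l) - A^T *m l)).
rewrite -xhat_fixpoint.
suff -> : xh l + grad H0 (xh l) - A^T *m l - xh l = grad H0 (xh l) - A^T *m l by [].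
by apply/colP => i; rewrite !mxE; ring.
Qed.

End Xhat.

Section Dual.
Context {R : realType} {d1 d2 : nat} (rho : R) (X : set 'cV[R]_d1).
Variables (H0 : 'cV[R]_d1 -> R) (A : 'M[R]_(d2, d1)) (b0 : 'cV[R]_d2).
Variable (xh : 'cV[R]_d2 -> 'cV[R]_d1).
Hypotheses (rho0 : 0 < rho) (sH : supergradient rho H0 (grad H0)).
Hypotheses (xh_in : forall l, X (xh l)) (xh_VI : forall l y, X y ->
  dot (grad H0 (xh l) - A^T *m l) (y - xh l) <= 0).

Local Notation lag := (lagrangian H0 A b0).

(** Here [xh] is any map into [X] with the variational inequality, which makes [xh l] a maximizer;
    how [xhat] is chosen no longer matters. *)
Definition dual l := lag l (xh l).

Definition residual l := A *m xh l - b0.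

Lemma lagrangian_xhat l x : X x ->
  lag l x <= dual l - rho / 2 * sq (x - xh l).
Proof.
by move=> Xx; apply: (VI_quad (lagrangian_super A b0 l sH) Xx) => y; exact: xh_VI.
Qed.

Lemma dual_ge_lagrangian l x : X x -> lag l x <= dual l.
Proof.
move=> /(lagrangian_xhat l).
by have := mulr_ge0 (ltW rho0) (dot_ge0 (x - xh l)); lra.
Qed.

(** A maximum of functions affine in the multiplier is convex: testing the maximum at [m] with the
    point [xh l] exhibits [- residual l] as a subgradient. *)
Lemma dual_ge l m : dual l - dot (m - l) (residual l) <= dual m.
Proof.
have := dual_ge_lagrangian m (xh_in l).
rewrite /dual /lagrangian /residual dotDl dotNl.
lra.
Qed.

(** Adding the quadratic growth of the two Lagrangians at each other's maximizers bounds
    [rho * sq (xh m - xh l)] by [dot (m - l) (A *m (xh l - xh m))], and Young concludes. *)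
Lemma xhat_lipschitz l m : rho ^+ 2 * sq (xh m - xh l) <= sq (A^T *m (m - l)).
Proof.
have h1 := lagrangian_xhat l (xh_in m).
have h2 := lagrangian_xhat m (xh_in l).
have E : sq (xh l - xh m) = sq (xh m - xh l).
  by rewrite -(opprB (xh m)) dotNl dotNr opprK.
have ri : 0 < rho^-1 by rewrite invr_gt0.
have := dot_young (A^T *m (m - l)) (xh l - xh m) ri.
rewrite invrK E -dot_mulA.
move: h1 h2; rewrite E /dual /lagrangian.
have -> : dot (m - l) (A *m (xh l - xh m)) =
   dot m (A *m xh l - b0) - dot m (A *m xh m - b0)
   - (dot l (A *m xh l - b0) - dot l (A *m xh m - b0)).
  by rewrite mulmxBr !(dotDl, dotDr, dotNl, dotNr); ring.
move=> h1 h2 h3.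
have : rho * sq (xh m - xh l) <= rho^-1 * sq (A^T *m (m - l)) by lra.
by rewrite [leRHS]mulrC ler_pdivlMr// mulrAC -expr2.
Qed.

(** The residual in the first-order term changes from [m] to [l]; the quadratic growth of the
    Lagrangian around [xh l] exactly absorbs the [sq (xh m - xh l)] that Young produces. No
    derivative of [xh] is involved. *)
Lemma dual_le l m : dual m <=
  dual l - dot (m - l) (residual l) + (2 * rho)^-1 * sq (A^T *m (m - l)).
Proof.
have h1 := lagrangian_xhat l (xh_in m).
have ri : 0 < rho^-1 by rewrite invr_gt0.
have := dot_young (A^T *m (m - l)) (- (xh m - xh l)) ri.
rewrite invrK (dotNl (xh m - _)) !(dotNr (xh m - _)) opprK -dot_mulA => h3.
rewrite invfM; move: h1; rewrite /dual /residual /lagrangian => h1.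
have E : dot (m - l) (A *m (xh m - xh l)) =
   dot (m - l) (A *m xh m - b0) - dot (m - l) (A *m xh l - b0).
  by rewrite mulmxBr !(dotDr, dotNr); ring.
move: h1 h3; rewrite E !(dotDl m) !(dotNl l); lra.
Qed.

Lemma dual_smooth : exists2 K, 0 < K &
  forall l m, dual m <= dual l - dot (m - l) (residual l) + K * sq (m - l).
Proof.
have [c c0 hc] := dot_mul_bound A^T; have rho2 : 0 < (2 * rho)^-1.
  by rewrite invr_gt0 mulr_gt0.
exists ((2 * rho)^-1 * c); first exact: mulr_gt0.
move=> l m; apply: (le_trans (dual_le l m)).
by rewrite lerD2l -mulrA ler_pM2l.
Qed.

Lemma dual_continuous : continuous dual.
Proof.
have [K K0 hK] := dual_smooth; move=> l.
have subl : (fun m : 'cV[R]_d2 => m - l) @ l --> l - l.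
  by apply: (@cvgB _ _ _ (nbhs l) _ id (cst l)); [exact: cvg_id | exact: cvg_cst].
have lin : (fun m => dot (m - l) (residual l)) @ l --> (0 : R).
  rewrite (_ : (fun m => _) = (dot (residual l)) \o (fun m => m - l)); last first.
    by apply/funext => m; rewrite /= dotC.
  rewrite -[X in _ --> X](dot0r (residual l)) -(subrr l).
  exact: (cvg_comp _ _ subl (@dot_continuous_r _ _ (residual l) (l - l))).
have quad : (fun m => sq (m - l)) @ l --> (0 : R).
  rewrite -[X in _ --> X](dot0r (0 : 'cV[R]_d2)) -(subrr l).
  exact: (cvg_comp _ (fun u => sq u) subl (@dot_continuous _ _ (l - l))).
have c1 : (fun m => dual l - dot (m - l) (residual l)) @ l --> dual l.
  by rewrite -[X in _ --> X]subr0; apply: (cvgB (cvg_cst _) lin).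
have c2 : (fun m => dual l - dot (m - l) (residual l) + K * sq (m - l)) @ l
    --> dual l.
  rewrite -[X in _ --> X]addr0 -[X in _ + X](mulr0 K).
  by apply: (cvgD c1); apply: (cvgM (cvg_cst _) quad).
apply: (squeeze_cvgr _ c1 c2); apply: nearW => m; apply/andP; split.
  exact: dual_ge.
exact: hK.
Qed.

(** A gradient step of length [(2 * K)^-1] from [l] lowers the dual by [sq (residual l) / (4 * K)]
    and cannot go below the minimum. The step is along [+ residual l] since the gradient is
    [- residual l]. *)
Lemma dual_residual_bound K ls l : 0 < K ->
  (forall l m, dual m <= dual l - dot (m - l) (residual l) + K * sq (m - l)) ->
  (forall l, dual ls <= dual l) ->
  sq (residual l) <= 4 * K * (dual l - dual ls).
Proof.
move=> K0 hK lsmin; set r := residual l.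
have := hK l (l + (2 * K)^-1 *: r); have := lsmin (l + (2 * K)^-1 *: r).
rewrite -/r (_ : l + _ - l = (2 * K)^-1 *: r); last by rewrite addrC addKr.
rewrite !(dotZl, dotZr) => h1 h2.
have h3 : K * ((2 * K)^-1 * ((2 * K)^-1 * sq r)) = sq r / (4 * K).
  by field; rewrite gt_eqF.
have h4 : (2 * K)^-1 * sq r = 2 * (sq r / (4 * K)) by field; rewrite gt_eqF.
have : sq r / (4 * K) <= dual l - dual ls by lra.
by rewrite ler_pdivrMr ?mulr_gt0// mulrC.
Qed.

Variables (L delta : R) (z : 'cV[R]_d1).
Hypotheses (L0 : 0 <= L) (lH : lipschitz_sq L (grad H0)) (delta0 : 0 < delta).
Hypotheses (zX : forall x, sq (x - z) <= delta ^+ 2 -> X x) (Az : A *m z = b0).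

(* Moving from [z] by [delta] against [A^T l] stays in [X] and gains
   [delta * |A^T l|] in the Lagrangian. *)
Lemma dual_coercive : exists c, forall l,
  delta * enorm (A^T *m l) <= dual l + c.
Proof.
(* An upper bound of [- H0] on the ball of radius [delta] around [z], from the supergradient at the
   displaced point [q] and the Lipschitz bound on the gradient. *)
exists (sq (grad H0 z) + (L + 1 / 2) * delta ^+ 2 - H0 z) => l.
set a := A^T *m l.
pose t := if enorm a == 0 then 0 else delta / enorm a.
have ta : t * enorm a = if enorm a == 0 then 0 else delta.
  by rewrite /t; case: eqP => [->|/eqP a0]; rewrite ?mul0r// divfK.
have tta : t * sq a = delta * enorm a.
  rewrite -enorm_sq expr2 mulrA ta.
  by case: eqP => [->|//]; rewrite mul0r mulr0.
have t2a : t * (t * sq a) <= delta ^+ 2.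
  have -> : t * (t * sq a) = (t * enorm a) ^+ 2.
    by rewrite exprMn enorm_sq expr2 mulrA.
  by rewrite ta; case: eqP => // _; rewrite expr0n sqr_ge0.
set q := z - t *: a.
have qz : q - z = - (t *: a) by rewrite /q addrC addKr.
have Xq : X q.
  by apply: zX; rewrite qz dotNl dotNr opprK dotZl dotZr.
have := dual_ge_lagrangian l Xq.
have -> : lag l q = H0 q + delta * enorm a.
  rewrite /lagrangian mulmxBr Az addrAC subrr add0r dotNr opprK.
  by rewrite dot_mulA dotZr tta.
have := sH q z; have -> : z - q = t *: a by rewrite -opprB qz opprK.
have := mulr_ge0 (ltW rho0) (dot_ge0 (t *: a)).
have := dot_young (grad H0 q) (t *: a) ltr01; rewrite invr1.
have := lH q z; rewrite qz dotNl dotNr opprK.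
have := dotD_le (grad H0 q - grad H0 z) (grad H0 z); rewrite subrK.
have : sq (t *: a) <= delta ^+ 2 by rewrite dotZl dotZr.
have := dot_ge0 (t *: a).
move: (sq (t *: a)) => w w0 wd hv hu h1 h2 h3 h4.
have := ler_wpM2l L0 wd; lra.
Qed.

Hypothesis xh_kernel : forall l m, A^T *m l = A^T *m m -> xh l = xh m.

Lemma dual_kernel l m : A^T *m l = A^T *m m -> dual l = dual m.
Proof.
move=> lm; rewrite /dual /lagrangian (xh_kernel lm) -Az -mulmxBr.
by rewrite !dot_mulA lm.
Qed.

(* [l^T] is replaced by the preimage of [l^T A] given by the pseudo-inverse, which
   has the same image under [A^T] and is controlled by it. *)
Lemma dual_minimizer : exists ls, forall l, dual ls <= dual l.
Proof.
have [c coer] := dual_coercive.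
have [k k0 hk] := dot_mul_bound (pinvmx A)^T.
(* Where [dual l <= dual 0], coercivity bounds [A^T l] by [(dual 0 + c) / delta], and [k] bounds the
   pseudo-inverse. Larger values of the dual are settled by comparison with 0, which lies in [Y]. *)
pose r := k * ((dual 0 + c) / delta) ^+ 2.
have r0 : 0 <= r by rewrite mulr_ge0 ?sqr_ge0// ltW.
pose Y := [set l : 'cV[R]_d2 | sq l <= r].
have clY : closed Y.
  apply: (preimage_closed _ (@closed_le _ _)) => x _; exact: dot_continuous.
have Y0 : Y 0 by rewrite /Y/= dot0r.
have [||ls _ lsmin] := cV_argmax (f := - dual) (r := r) Y0 clY.
- by move=> l; apply: continuousN; exact: dual_continuous.
- by move=> l; rewrite subr0.
exists ls => l; have [lt0|/ltW] := leP (dual l) (dual 0); last first.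
  by apply: le_trans; rewrite -lerN2; exact: lsmin.
pose l' := (pinvmx A)^T *m (A^T *m l).
have ll' : A^T *m l = A^T *m l'.
  apply: trmx_inj; rewrite /l' !trmx_mul !trmxK.
  by rewrite mulmxKpV// submxMl.
rewrite (dual_kernel ll') -lerN2; apply: lsmin.
apply: (le_trans (hk _)); rewrite ler_pM2l//.
have h : enorm (A^T *m l) <= (dual 0 + c) / delta.
  rewrite ler_pdivlMr// mulrC; have := coer l; lra.
by rewrite -enorm_sq ler_pXn2r ?nnegrE ?enorm_ge0// (le_trans (enorm_ge0 _) h).
Qed.

End Dual.

(** * One step of the method *)

Section OneStep.
Context {R : realType} {d1 d2 : nat} (rho L : R) (X : set 'cV[R]_d1).
Variables (H0 : 'cV[R]_d1 -> R) (A : 'M[R]_(d2, d1)) (b0 : 'cV[R]_d2).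
Variable (xh : 'cV[R]_d2 -> 'cV[R]_d1).
Hypotheses (rho0 : 0 < rho) (sH : supergradient rho H0 (grad H0)).
Hypotheses (L0 : 0 <= L) (lH : lipschitz_sq L (grad H0)).
Hypotheses (cX : convex_cV X) (clX : closed X).
Hypotheses (xh_in : forall l, X (xh l)) (xh_VI : forall l y, X y ->
  dot (grad H0 (xh l) - A^T *m l) (y - xh l) <= 0).
Variable ls : 'cV[R]_d2.
Hypothesis lsmin : forall l, dual H0 A b0 xh ls <= dual H0 A b0 xh l.
Variables (alpha_max Gam : R).

Local Notation res := (residual A b0 xh).
Local Notation D := (dual H0 A b0 xh).
Local Notation err x l := (sq (x - xh l)).
Local Notation weight x l := (1 + sq (x - xh l) + sq (l - ls)).

Lemma residual_min : res ls = 0.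
Proof.
have [K K0 hK] := dual_smooth b0 rho0 sH xh_in xh_VI.
apply/dot_eq0/le_anti; rewrite dot_ge0 andbT.
by have := dual_residual_bound ls K0 hK lsmin; rewrite subrr mulr0.
Qed.

Lemma xhat_lip : exists2 c, 0 < c &
  forall l m, sq (xh m - xh l) <= c * sq (m - l).
Proof.
have [c c0 hc] := dot_mul_bound A^T; have r2 : 0 < rho ^+ 2 by rewrite exprn_gt0.
exists (c / rho ^+ 2); first by rewrite divr_gt0.
move=> l m; have h1 := xhat_lipschitz b0 rho0 sH xh_in xh_VI l m.
rewrite mulrAC ler_pdivlMr// mulrC; exact: le_trans h1 (hc _).
Qed.

Lemma constraint_split x l : A *m x - b0 = A *m (x - xh l) + res l.
Proof. by rewrite mulmxBr addrA subrK. Qed.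

(** By [residual_min] the constraint holds exactly at [xh ls], so the violation at any state is
    controlled by the distances to it. *)
Lemma constraint_bound : exists2 c, 0 < c &
  forall x l, sq (A *m x - b0) <= c * weight x l.
Proof.
have [cA cA0 hA] := dot_mul_bound A; have [cx cx0 hx] := xhat_lip.
exists (2 * cA + 2 * cA * cx); first by rewrite addr_gt0 ?mulr_gt0.
move=> x l; have -> : A *m x - b0 = A *m (x - xh l) + A *m (xh l - xh ls).
  rewrite (constraint_split x l) -{1}[res l]subr0 -residual_min /residual.
  by congr (_ + _); rewrite mulmxBr opprB addrA subrK.
apply: (le_trans (dotD_le _ _)).
have h1 := hA (x - xh l); have h2 := hA (xh l - xh ls).
have h3 : cA * sq (xh l - xh ls) <= cA * (cx * sq (l - ls)) by rewrite ler_pM2l.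
have := mulr_ge0 (ltW cA0) (dot_ge0 (l - ls)).
have := mulr_ge0 (mulr_ge0 (ltW cA0) (ltW cx0)) (dot_ge0 (x - xh l)).
have := mulr_ge0 (ltW cA0) (ltW cx0).
lra.
Qed.

(** Converts the growth condition on the noise, stated in the raw state, into the weight. *)
Lemma state_bound : exists2 c, 0 < c &
  forall x l, 1 + sq x + sq l <= c * weight x l.
Proof.
have [cx cx0 hx] := xhat_lip.
have cs0 := dot_ge0 ls; have cxs0 := dot_ge0 (xh ls).
exists (3 + 4 * cx + 4 * sq (xh ls) + 2 * sq ls).
  by rewrite !ltr_wpDr// ?mulr_ge0// ltW.
move=> x l.
have := dotD_le (x - xh l) (xh l); rewrite subrK.
have := dotD_le (xh l - xh ls) (xh ls); rewrite subrK.
have := dotD_le (l - ls) ls; rewrite subrK.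
have := hx ls l.
have := dot_ge0 (x - xh l); have := dot_ge0 (l - ls).
move: (sq (x - xh l)) (sq (l - ls)) (sq (xh ls)) (sq ls) cs0 cxs0.
move=> a b p q p0 q0 b0' a0'.
have := mulr_ge0 (ltW cx0) a0'; have := mulr_ge0 p0 a0'; have := mulr_ge0 p0 b0'.
have := mulr_ge0 q0 a0'; have := mulr_ge0 q0 b0'; lra.
Qed.

(** The projected step contracts towards [xh l] at rate [2 * rho * alpha]. Half of this pays for a
    Young inequality of weight [rho * alpha] that moves the target to the new multiplier. The term
    linear in [v] is kept exact because its conditional mean vanishes. *)
Lemma err_step : exists2 C, 0 < C & forall alpha beta x l (v : 'cV[R]_d1),
  0 < alpha <= alpha_max -> beta ^+ 2 <= Gam * alpha ^+ 3 ->
  err (proj X (x + alpha *: (grad H0 x - A^T *m l + v)))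
      (l + beta *: (A *m x - b0))
  <= (1 - rho * alpha) * err x l
    + 2 * alpha * (1 + rho * alpha) *
        dot (x - xh l + alpha *: (grad H0 x - grad H0 (xh l))) v
    + C * alpha ^+ 2 * (sq v + weight x l).
Proof.
have [cx cx0 hx] := xhat_lip; have [cr cr0 hr] := constraint_bound.
(* [C1] collects the second-order part of the contraction, [C2] multiplies the squared noise, [C3]
   the displacement of [xh]. Absolute values avoid sign assumptions on [alpha_max] and [Gam]. *)
pose C1 := L + rho * L * `|alpha_max|; pose C2 := 1 + rho * `|alpha_max|.
pose C3 := `|Gam| * (`|alpha_max| + rho^-1) * (cx * cr).
have ri0 : 0 < rho^-1 by rewrite invr_gt0.
have am0 := normr_ge0 alpha_max; have g0 := normr_ge0 Gam.
have C10 : 0 <= C1 by rewrite addr_ge0// !mulr_ge0// ltW.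
have C20 : 0 < C2 by rewrite ltr_pwDl// mulr_ge0// ltW.
have C30 : 0 <= C3 by rewrite !mulr_ge0// ?addr_ge0// ltW.
exists (C1 + C2 + C3); first by rewrite ltr_wpDr// ltr_wpDl.
move=> al be x l v /andP[al0 alm] beal.
have {}alm : al <= `|alpha_max| by rewrite (le_trans alm)// ler_norm.
set e := x - xh l; set dG := grad H0 x - grad H0 (xh l); set u := e + al *: dG.
set x' := proj _ _; set l' := l + _; set w := 1 + sq (x - xh l) + sq (l - ls).
have hx' : sq (x' - xh l) <= sq u + 2 * al * dot u v + al ^+ 2 * sq v.
  (* Scaling the drift leaves the variational inequality unchanged. *)
  have E : xh l = proj X (xh l + al *: (grad H0 (xh l) - A^T *m l)).
    apply: proj_unique => //; first by exists (xh l).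
    by move=> y Xy; rewrite addrC addKr dotZl mulr_ge0_le0 ?xh_VI// ltW.
  rewrite {1 2}E; apply: (le_trans (proj_nonexpansive cX clX _ _ _)).
    by exists (xh l).
  rewrite (_ : _ - _ = u + al *: v); last first.
    by rewrite /u /e /dG; apply/colP => i; rewrite !mxE; ring.
  by clearbody u; rewrite !dotE (dotC v u); lra.
have hu : sq u <= (1 - 2 * rho * al + L * al ^+ 2) * sq e.
  have h1 := supergradient_mono sH x (xh l).
  have h2 := lH x (xh l).
  rewrite -/dG -/e in h1 h2.
  rewrite /u; clearbody e dG; rewrite !dotE (dotC e dG).
  by have := ler_wpM2l (sqr_ge0 al) h2; have := ler_wpM2l (ltW al0) h1; lra.
have hl : sq (xh l - xh l') <= cx * cr * be ^+ 2 * w.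
  have -> : cx * cr * be ^+ 2 * w = cx * (be ^+ 2 * (cr * w)) by ring.
  rewrite (le_trans (hx _ _))// ler_pM2l// -opprB dotNl dotNr opprK /l'.
  rewrite addrC addKr dotZl dotZr mulrA -expr2 ler_wpM2l ?sqr_ge0//.
  exact: hr.
have ra0 : 0 < rho * al by rewrite mulr_gt0.
have := dotD_young (x' - xh l) (xh l - xh l') ra0; rewrite addrA subrK.
have w1 : 1 <= w by rewrite /w -addrA lerDl addr_ge0 ?dot_ge0.
have a20 : 0 <= al ^+ 2 := sqr_ge0 _.
have w0 : 0 <= w := le_trans ler01 w1.
have t2 : (1 + (rho * al)^-1) * err (xh l) l' <= C3 * al ^+ 2 * w.
  have i0 : 0 <= 1 + (rho * al)^-1 by rewrite addr_ge0// invr_ge0 ltW.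
  apply: (le_trans (ler_wpM2l i0 hl)).
  have k1 : (1 + (rho * al)^-1) * be ^+ 2 <= `|Gam| * (`|alpha_max| + rho^-1) * al ^+ 2.
    have k2 : be ^+ 2 <= `|Gam| * al ^+ 3.
      by rewrite (le_trans beal)// ler_pM2r ?exprn_gt0// ler_norm.
    apply: (le_trans (ler_wpM2l i0 k2)).
    have -> : (1 + (rho * al)^-1) * (`|Gam| * al ^+ 3) = `|Gam| * (al + rho^-1) * al ^+ 2.
      by field; rewrite !gt_eqF.
    by rewrite ler_wpM2r// ler_wpM2l// lerD2r.
  have cw0 : 0 <= cx * cr * w by rewrite !mulr_ge0// ltW.
  by have := ler_wpM2r cw0 k1; rewrite /C3; lra.
have t1 : (1 + rho * al) * sq u <= (1 - rho * al) * sq e + C1 * al ^+ 2 * w.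
  have i0 : 0 <= 1 + rho * al by rewrite addr_ge0// ltW.
  apply: (le_trans (ler_wpM2l i0 hu)).
  have ew : sq e <= w.
    by have := dot_ge0 (l - ls); rewrite /w; lra.
  have k1 := ler_wpM2l (mulr_ge0 C10 a20) ew.
  have k2 : al ^+ 2 * (rho * L) * al <= al ^+ 2 * (rho * L) * `|alpha_max|.
    by rewrite ler_wpM2l// !mulr_ge0// ltW//.
  have k3 := ler_wpM2r (dot_ge0 e) k2.
  have k4 := mulr_ge0 (mulr_ge0 (sqr_ge0 rho) a20) (dot_ge0 e).
  by move: k1 k3; rewrite /C1; lra.
have t3 : (1 + rho * al) * (al ^+ 2 * sq v) <= C2 * al ^+ 2 * sq v.
  have k1 : 1 + rho * al <= C2 by rewrite lerD2l ler_wpM2l// ltW.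
  rewrite -[leRHS]mulrA; exact: ler_wpM2r (mulr_ge0 a20 (dot_ge0 v)) _ _ k1.
have t4 : (1 + rho * al) * err x' l <= (1 + rho * al) * (sq u + 2 * al * dot u v + al ^+ 2 * sq v).
  by rewrite ler_wpM2l// addr_ge0// ltW.
have t5 := mulr_ge0 (mulr_ge0 C10 a20) (dot_ge0 v).
have t6 := mulr_ge0 (mulr_ge0 C30 a20) (dot_ge0 v).
have t7 := mulr_ge0 (mulr_ge0 (ltW C20) a20) w0.
by move=> /le_trans; apply; lra.
Qed.

Let gap_ge0 l : 0 <= D l - D ls.
Proof. by rewrite subr_ge0. Qed.

Lemma dual_gap_convex l : D l - D ls <= - dot (l - ls) (res l).
Proof.
have := dual_ge b0 rho0 sH xh_in xh_VI l ls.
by rewrite -(opprB l ls) dotNl; lra.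
Qed.

(** By convexity of the dual, the residual at [xh l] does not point away from [ls]; only
    [A *m (x - xh l)] can. Young with weight [alpha^2 / beta] leaves [alpha^2] on the distance to
    [ls] and [beta^2 / alpha^2 = O(alpha)] on the error. *)
Lemma multiplier_step : exists2 C, 0 < C & forall alpha beta x l,
  0 < alpha <= alpha_max -> 0 < beta -> beta ^+ 2 <= Gam * alpha ^+ 3 ->
  sq (l + beta *: (A *m x - b0) - ls)
  <= sq (l - ls) + C * alpha * err x l + C * alpha ^+ 2 * weight x l.
Proof.
have [cA cA0 hA] := dot_mul_bound A; have [cr cr0 hr] := constraint_bound.
have am0 := normr_ge0 alpha_max; have g0 := normr_ge0 Gam.
exists (1 + `|Gam| * cA + `|Gam| * `|alpha_max| * cr).
  by rewrite -addrA ltr_pwDl// addr_ge0// !mulr_ge0// ltW.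
move=> al be x l /andP[al0 alm] be0 beal.
have {}alm : al <= `|alpha_max| by rewrite (le_trans alm)// ler_norm.
have {}beal : be ^+ 2 <= `|Gam| * al ^+ 3.
  by rewrite (le_trans beal)// ler_pM2r ?exprn_gt0// ler_norm.
rewrite addrAC; set r := A *m x - b0; set w := 1 + sq (x - xh l) + sq (l - ls); set e := x - xh l.
set y := l - ls.
have rE : dot y r = dot y (A *m e) + dot y (res l).
  by rewrite /r (constraint_split x l) dotDr.
have E : sq (y + be *: r) = sq y + 2 * be * dot y r + be ^+ 2 * sq r.
  by clearbody y r; rewrite !dotE (dotC r y); ring.
have yres : dot y (res l) <= 0 by have := dual_gap_convex l; have := gap_ge0 l; lra.
have w1 : 1 <= w by rewrite /w -addrA lerDl addr_ge0 ?dot_ge0.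
have a20 : 0 < al ^+ 2 by rewrite exprn_gt0.
have k1 : 2 * be * dot y (A *m e) <= al ^+ 2 * sq y + `|Gam| * cA * al * sq e.
  have s0 : 0 < al ^+ 2 / be by rewrite divr_gt0.
  have := ler_wpM2l (ltW be0) (dot_young y (A *m e) s0).
  have -> : be * (al ^+ 2 / be * sq y + (al ^+ 2 / be)^-1 * sq (A *m e))
     = al ^+ 2 * sq y + be ^+ 2 / al ^+ 2 * sq (A *m e).
    by field; rewrite !gt_eqF.
  have k2 : be ^+ 2 / al ^+ 2 <= `|Gam| * al by rewrite ler_pdivrMr//; lra.
  have k3 : be ^+ 2 / al ^+ 2 * sq (A *m e) <= `|Gam| * al * (cA * sq e).
    by apply: ler_pM => //; [rewrite divr_ge0 ?sqr_ge0 | exact: dot_ge0].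
  lra.
have k2 : be ^+ 2 * sq r <= `|Gam| * `|alpha_max| * cr * al ^+ 2 * w.
  have k3 : be ^+ 2 <= `|Gam| * `|alpha_max| * al ^+ 2.
    apply: (le_trans beal); rewrite exprS mulrA.
    by rewrite ler_pM2r// ler_wpM2l.
  have -> : `|Gam| * `|alpha_max| * cr * al ^+ 2 * w =
     `|Gam| * `|alpha_max| * al ^+ 2 * (cr * w) by ring.
  by apply: ler_pM => //; [exact: sqr_ge0 | exact: dot_ge0 | exact: hr].
have yw : sq y <= w by have := dot_ge0 e; rewrite /w; lra.
have k3 := ler_wpM2l (ltW a20) yw.
have k4 := mulr_ge0 (mulr_ge0 (mulr_ge0 g0 (ltW cA0)) (ltW a20)) (le_trans ler01 w1).
have k5 := mulr_ge0 (mulr_ge0 (mulr_ge0 g0 am0) (ltW cr0)) (mulr_ge0 (ltW al0) (dot_ge0 e)).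
have k6 := mulr_ge0 (ltW al0) (dot_ge0 e).
have k7 : be * dot y (res l) <= 0 by rewrite mulr_ge0_le0// ltW.
rewrite E rE; lra.
Qed.

(** A gradient step on the dual whose gradient is perturbed by [A *m (x - xh l)]; half of the
    decrease [beta * sq (res l)] absorbs the cross term. *)
Lemma dual_step : exists2 C, 0 < C & forall beta x l, 0 < beta ->
  D (l + beta *: (A *m x - b0)) + beta / 2 * sq (res l)
  <= D l + C * beta * err x l + C * beta ^+ 2 * weight x l.
Proof.
have [cA cA0 hA] := dot_mul_bound A; have [cr cr0 hr] := constraint_bound.
have [K K0 hK] := dual_smooth b0 rho0 sH xh_in xh_VI.
exists (cA + K * cr); first by rewrite addr_gt0// mulr_gt0.
move=> be x l be0; have := hK l (l + be *: (A *m x - b0)).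
set r := A *m x - b0; set w := 1 + sq (x - xh l) + sq (l - ls); set e := x - xh l.
rewrite [l + _ - l]addrC addKr => h1.
have rE : dot r (res l) = dot (A *m e) (res l) + sq (res l).
  by rewrite {1}/r (constraint_split x l) dotDl.
have h2 : - 2 * dot (A *m e) (res l) <= sq (A *m e) + sq (res l).
  have := dot_ge0 (A *m e + res l).
  by rewrite (dotDl (A *m e)) !(dotDr (A *m e)) (dotC (res l)); lra.
have w0 : 0 <= w by rewrite !addr_ge0 ?dot_ge0.
have h3 := ler_wpM2l (mulr_ge0 (ltW K0) (sqr_ge0 be)) (hr x l).
rewrite -/r -/w in h3.
have h4 := ler_wpM2l (ltW be0) h2.
have h5 := ler_wpM2l (ltW be0) (hA e).
have h6 := mulr_ge0 (mulr_ge0 (ltW cA0) (sqr_ge0 be)) w0.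
have h7 := mulr_ge0 (mulr_ge0 (mulr_ge0 (ltW K0) (ltW cr0)) (ltW be0)) (dot_ge0 e).
have h8 := mulr_ge0 (mulr_ge0 (ltW cA0) (ltW be0)) (dot_ge0 e).
move: h1; rewrite (dotZl _ r) (dotZl _ r) (dotZr _ r) rE; lra.
Qed.

Lemma dual_gap_le : exists2 C, 0 < C &
  forall l, D l - D ls <= C * sq (l - ls) /\ sq (res l) <= C * (D l - D ls).
Proof.
have [K K0 hK] := dual_smooth b0 rho0 sH xh_in xh_VI.
exists (4 * K); first by rewrite mulr_gt0.
move=> l; split; last exact: (dual_residual_bound l K0 hK lsmin).
have := hK ls l; rewrite residual_min dot0r.
by have := mulr_ge0 (ltW K0) (dot_ge0 (l - ls)); lra.
Qed.

(** Expand [sq (t *: (l - ls) + res l) >= 0] and use convexity. The optimal [t] would give the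
    squared gap over [sq (l - ls)]; with [t] fixed the bound is linear in both and can be
    integrated. *)
Lemma residual_ge t l : 0 < t ->
  2 * t * (D l - D ls) - t ^+ 2 * sq (l - ls) <= sq (res l).
Proof.
move=> t0; have := dual_gap_convex l => h1.
have := dot_ge0 (t *: (l - ls) + res l).
rewrite (dotDl (t *: _)) !(dotDr (t *: _)) !(dotZl t) !(dotZr t) (dotC (res l)).
by have := ler_wpM2l (ltW t0) h1; lra.
Qed.

Lemma constraint_le : exists2 C, 0 < C &
  forall x l, sq (A *m x - b0) <= C * (err x l + (D l - D ls)).
Proof.
have [cA cA0 hA] := dot_mul_bound A; have [C C0 hC] := dual_gap_le.
exists (2 * cA + 2 * C); first by rewrite addr_gt0 ?mulr_gt0.
move=> x l; rewrite (constraint_split x l).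
apply: (le_trans (dotD_le _ _)).
have := hA (x - xh l); have [_] := hC l.
have := mulr_ge0 (ltW C0) (dot_ge0 (x - xh l)).
have := mulr_ge0 (ltW cA0) (gap_ge0 l); lra.
Qed.

End OneStep.

(** * Power sequences *)

Section PowerSequences.
Context {R : realType}.
Implicit Types N r c : R.

(** A Bernoulli inequality for [1 + N^-1], from [ln (1 + x) <= x] and [1 + x <= expR x];
    [powR_succ_le] does the same with [1 - (N + 1)^-1]. *)
Lemma powR_succ_ge N r : 0 < N -> 0 <= r ->
  N `^ (- r) * (1 - r / N) <= (N + 1) `^ (- r).
Proof.
move=> N0 r0; have iN : 0 < N^-1 by rewrite invr_gt0.
have -> : N + 1 = N * (1 + N^-1) by rewrite mulrDr mulr1 mulfV// gt_eqF.
rewrite powRM ?(ltW N0)//; last by rewrite addr_ge0// ltW.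
rewrite ler_wpM2l ?powR_ge0// /powR gt_eqF ?addr_gt0//.
have h1 : ln (1 + N^-1) <= N^-1 by apply: le_ln1Dx; rewrite (lt_trans _ iN)// ltrN10.
apply: le_trans (expR_ge1Dx _); rewrite lerD2l mulNr lerN2.
exact: ler_wpM2l.
Qed.

Lemma powR_succ_le N r : 0 < N -> 0 <= r ->
  (N + 1) `^ (- r) * (1 + r / (N + 1)) <= N `^ (- r).
Proof.
move=> N0 r0; have N10 : 0 < N + 1 by rewrite addr_gt0.
have iN : (N + 1)^-1 < 1 by rewrite invf_lt1// ltrDr.
have E : N = (N + 1) * (1 - (N + 1)^-1).
  by rewrite mulrBr mulr1 mulfV ?gt_eqF// addrK.
rewrite [in leRHS]E powRM ?(ltW N10)//; last by rewrite subr_ge0 ltW.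
rewrite ler_wpM2l ?powR_ge0// /powR gt_eqF ?subr_gt0//.
have h1 : ln (1 - (N + 1)^-1) <= - (N + 1)^-1 by apply: le_ln1Dx; rewrite ltrN2.
apply: le_trans (expR_ge1Dx _); rewrite lerD2l mulNr -mulrN.
by rewrite ler_wpM2l// lerNr.
Qed.

Lemma powR_negK N r : 0 < N -> N `^ r * N `^ (- r) = 1.
Proof. by move=> N0; rewrite powRN mulfV// gt_eqF// powR_gt0. Qed.

Variable K1 : R.
Hypothesis K11 : 1 <= K1.

Let n_ (k : nat) : R := k%:R + K1.

Let n_ge1 k : 1 <= n_ k.
Proof. by rewrite ler_wpDl. Qed.

Let n_gt0 k : 0 < n_ k.
Proof. exact: lt_le_trans ltr01 (n_ge1 k). Qed.

Let n_S k : n_ k.+1 = n_ k + 1.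
Proof. by rewrite /n_ -natr1 addrAC. Qed.

Lemma powR_shift_small r c : 0 < r -> 0 < c ->
  exists k0, forall k, (k0 <= k)%N -> (k%:R + K1) `^ (- r) <= c.
Proof.
move=> r0 c0; exists (Num.truncn (c^-1 `^ r^-1)).+1 => k kk.
have h : c^-1 `^ r^-1 <= n_ k.
  rewrite ltW// (lt_le_trans (truncnS_gt _))//.
  by rewrite ler_wpDr ?ler_nat// (le_trans ler01).
rewrite -/(n_ k) powRN -[leRHS]invrK lef_pV2 ?posrE ?powR_gt0 ?invr_gt0//.
have E : c^-1 = (c^-1 `^ r^-1) `^ r.
  by rewrite -powRrM mulVf ?gt_eqF// powRr1// invr_ge0 ltW.
rewrite [leLHS]E; apply: (ge0_ler_powR (ltW r0)) => //; rewrite nnegrE.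
  exact: powR_ge0.
exact: ltW.
Qed.

(** One half of the contraction [p k], at least r/n for n = k + K1, covers the relative decrease of
    n^(-r) over a step; the other half covers the forcing, as [B >= 2 * C]. *)
Lemma recursion_rate r C k0 (p u : nat -> R) : 0 <= r -> 0 <= C ->
  (forall k, (k0 <= k)%N -> [/\ 0 <= p k <= 1, 2 * r <= p k * (k%:R + K1) &
     u k.+1 <= (1 - p k) * u k + C * p k * (k%:R + K1) `^ (- r)]) ->
  exists2 B, 0 <= B & forall k, u k <= B * (k%:R + K1) `^ (- r).
Proof.
move=> r0 C0 H.
pose v j := `|u j| * n_ j `^ r.
have v0 j : 0 <= v j by rewrite mulr_ge0// powR_ge0.
exists (2 * C + \sum_(j < k0.+1) v j).
  by rewrite addr_ge0 ?mulr_ge0// sumr_ge0.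
set B := _ + _ => k; rewrite -/(n_ k).
have BC : 2 * C <= B by rewrite lerDl sumr_ge0.
have [|] := leqP k k0 => kk.
  apply: (@le_trans _ _ (v k * n_ k `^ (- r))).
    by rewrite /v -mulrA powR_negK// mulr1 ler_norm.
  rewrite ler_wpM2r ?powR_ge0// /B (bigD1 (Ordinal (kk : (k < k0.+1)%N)))//=.
  by rewrite addrCA lerDl addr_ge0 ?mulr_ge0// sumr_ge0.
elim: k kk => // k IH; rewrite ltnS => kk.
have {IH} uk : u k <= B * n_ k `^ (- r).
  move: kk; rewrite leq_eqVlt => /orP[/eqP<-|]; last exact: IH.
  apply: (@le_trans _ _ (v k0 * n_ k0 `^ (- r))).
    by rewrite /v -mulrA powR_negK// mulr1 ler_norm.
  rewrite ler_wpM2r ?powR_ge0// /B (bigD1 (@ord_max k0))//=.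
  by rewrite addrCA lerDl addr_ge0 ?mulr_ge0// sumr_ge0.
have [/andP[p0 p1] pn uk1] := H k kk.
apply: (le_trans uk1).
have := powR_succ_ge (n_gt0 k) r0; rewrite -n_S -/(n_ k).
move: uk pn; rewrite -!/(n_ _); set X := _ `^ _; set Y := _ `^ _ => uk pn hXY.
have X0 : 0 <= X by rewrite powR_ge0.
have B0 : 0 <= B by rewrite (le_trans _ BC) ?mulr_ge0.
have h1 : (1 - p k) * u k <= (1 - p k) * (B * X) by rewrite ler_wpM2l// subr_ge0.
have h2 : B * (X * (1 - r / n_ k)) <= B * Y by rewrite ler_wpM2l.
apply: le_trans h2.
have h3 : r / n_ k <= p k / 2.
  by rewrite ler_pdivrMr//; lra.
have h4 : 2 * C * p k * X <= B * p k * X by rewrite !ler_wpM2r.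
have h5 : B * X * (r / n_ k) <= B * X * (p k / 2) by rewrite ler_wpM2l// mulr_ge0.
lra.
Qed.

(* Weighting by [1 + T k] turns growth by the factors [1 + G n^(-(1 + d))] into
   monotonicity. *)
Lemma discount d G : 0 < d <= 1 -> 0 <= G ->
  exists T : nat -> R, exists k0, [/\ forall k, 0 <= T k,
    forall c, 0 < c -> exists k1, forall k, (k1 <= k)%N -> T k <= c &
    forall k, (k0 <= k)%N ->
      (1 + T k.+1) * (1 + G * (k%:R + K1) `^ (- (1 + d))) <= 1 + T k].
Proof.
(* [T] drops over a step by at least D d / (N + 1) times its new power Y, that is 8 G Y / (N + 1).
   The growth to compensate is at most twice g <= 4 G Y / (N + 1), once [T <= 1]. *)
move=> /andP[d0 d1] G0; pose D := 8 * G / d.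
have D0 : 0 <= D by rewrite divr_ge0 ?mulr_ge0// ltW.
pose T k := D * n_ k `^ (- d).
have T0 k : 0 <= T k by rewrite mulr_ge0 ?powR_ge0.
have Tc c : 0 < c -> exists k1, forall k, (k1 <= k)%N -> T k <= c.
  move=> c0; have D1 : 0 < D + 1 by rewrite ltr_wpDl.
  have [k1 hk1] := powR_shift_small d0 (divr_gt0 c0 D1).
  exists k1 => k /hk1; rewrite ler_pdivlMr// -/(n_ k) => h.
  by apply: le_trans h; rewrite /T mulrC ler_wpM2l ?powR_ge0// lerDl.
have [k0 hk0] := Tc 1 ltr01.
exists T, k0; split => // k kk.
have T'1 : T k.+1 <= 1 by apply: hk0; rewrite leqW.
rewrite -/(n_ k).
have N0 := n_gt0 k; have N1 := n_ge1 k; move: T'1 (T0 k.+1); rewrite /T n_S.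
move: (n_ k) N0 N1 => N N0 N1; set Y := (N + 1) `^ (- d) => T1 T'0.
have N10 : 0 < N + 1 by rewrite addr_gt0.
have Y0 : 0 <= Y by rewrite powR_ge0.
have hT : Y * (1 + d / (N + 1)) <= N `^ (- d) by apply: powR_succ_le => //; exact: ltW.
have hN : N `^ (- d) <= 2 * Y.
  have : (2 * N) `^ (- d) <= Y.
    rewrite /Y !powRN lef_pV2 ?posrE ?powR_gt0 ?mulr_gt0//.
    by apply: (ge0_ler_powR (ltW d0)); rewrite ?nnegrE; lra.
  rewrite powRM ?(ltW N0)// => h.
  have : 2^-1 <= (2 : R) `^ (- d).
    rewrite powRN lef_pV2 ?posrE ?powR_gt0//.
    by rewrite -[leRHS](powRr1 (a := 2))// ler_powR ?ler1n.
  move=> /(ler_wpM2r (powR_ge0 N (- d))) h2.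
  have := le_trans h2 h; lra.
set g := G * _.
have hg : g <= 4 * G * (Y / (N + 1)).
  rewrite /g opprD powRD; last by rewrite (gt_eqF N0) implybT.
  rewrite powR_inv1 ?(ltW N0)// (mulrC 4 G) -[leRHS]mulrA; apply: ler_wpM2l => //.
  have h : N^-1 <= 2 / (N + 1).
    by rewrite ler_pdivlMr// mulrC ler_pdivrMr//; lra.
  have -> : 4 * (Y / (N + 1)) = 2 / (N + 1) * (2 * Y) by ring.
  by apply: ler_pM => //; [rewrite invr_ge0 ltW | exact: powR_ge0].
have g0 : 0 <= g by rewrite mulr_ge0 ?powR_ge0.
have h1 : D * (Y * (1 + d / (N + 1))) <= D * N `^ (- d) by rewrite ler_wpM2l.
have h2 : D * (Y * (d / (N + 1))) = 8 * G * (Y / (N + 1)).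
  by rewrite /D; field; rewrite !gt_eqF.
have : (1 + D * Y) * g <= 2 * g by rewrite ler_wpM2r//; lra.
lra.
Qed.

End PowerSequences.

(** * Measurability *)

Section ContinuousMeasurable.
Context {R : realType} {d} {T : measurableType d} {n : nat}.
Variables (f : 'cV[R]_n -> R) (X : T -> 'cV[R]_n).
Hypotheses (cf : continuous f)
  (mX : forall i, measurable_fun setT (fun w => X w i 0)).

Let box (q : {ffun 'I_n -> rat} * nat) : set 'cV[R]_n :=
  [set v | forall i, `|ratr (q.1 i) - v i 0| < q.2.+1%:R^-1].

Let box_measurable q : measurable (X @^-1` box q).
Proof.
have -> : X @^-1` box q = \bigcap_i
    ((fun w => X w i 0) @^-1` ball (ratr (q.1 i) : R) q.2.+1%:R^-1).
  by apply/seteqP; split=> w h i; [move=> _; exact: h | exact: (h i I)].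
apply: fin_bigcap_measurable => // i _.
rewrite -[_ @^-1` _]setTI; apply: mX => //; exact: measurable_ball.
Qed.

Let box_dense (U : set 'cV[R]_n) v : open U -> U v ->
  exists2 q, box q `<=` U & box q v.
Proof.
move=> oU Uv; have /nbhs_ballP[e /= e0 eU] : nbhs v U by exact: open_nbhs_nbhs.
pose N := Num.truncn (2 / e).
(* A box containing [v] then has all its points within [e] of [v]. *)
have Ne : N.+1%:R^-1 < e / 2.
  by rewrite invf_plt ?posrE ?divr_gt0// invf_div truncnS_gt.
have N0 : 0 < N.+1%:R^-1 :> R by rewrite invr_gt0.
have hq i : exists r : rat, `|ratr r - v i 0| < N.+1%:R^-1.
  have lt1 : v i 0 < v i 0 + N.+1%:R^-1 by rewrite ltrDl.
  have [r] := rat_in_itvoo lt1; rewrite in_itv/= => /andP[h1 h2]; exists r.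
  by rewrite ger0_norm ?subr_ge0 1?ltW// ltrBlDl.
have [q qP] := choice hq.
exists ([ffun i => q i], N) => [u bu|i]; last by rewrite ffunE; exact: qP.
apply: eU; split=> // i j; rewrite ord1 /ball/=.
have := bu i; rewrite ffunE => h1; have := qP i => h2.
rewrite (_ : v i 0 - u i 0 = (ratr (q i) - u i 0) - (ratr (q i) - v i 0)); last by ring.
by rewrite (le_lt_trans (ler_normB _ _))// (lt_trans (ltrD h1 h2))// [ltRHS]splitr ltrD.
Qed.

(** Only the coordinates of [X] are known to be measurable, so an open set is written as the
    countable union of the rational boxes inside it. *)
Lemma continuous_measurable : measurable_fun setT (f \o X).
Proof.
apply: (measurability _ (RGenOInfty.measurableE R)).
move=> _ [_ [a ->] <-]; rewrite setTI.
pose U := f @^-1` `]a, +oo[.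
have oU : open U.
  by apply: open_comp => [v _|]; [exact: cf | exact: interval_open].
rewrite (_ : _ @^-1` _ =
    \bigcup_(q in [set q | box q `<=` U]) (X @^-1` box q)); last first.
  apply/seteqP; split=> w; last by move=> [q qU Xq]; exact: (qU _ Xq).
  by move=> /(box_dense oU)[q qU Xq]; exists q.
rewrite bigcup_mkcond; apply: countable_bigcupT_measurable => // q.
by case: ifP => // _; exact: box_measurable.
Qed.

End ContinuousMeasurable.

(** * Integration over a sub-sigma-algebra *)

Section SubSigmaAlgebra.
Context {R : realType} {d} {T : measurableType d} (P : {measure set T -> \bar R}).
Variable gen : set (set T).
Hypothesis sub : <<s gen>> `<=` (measurable : set (set T)).

Local Notation T' := (g_sigma_algebraType gen).

Lemma sub_measurable_fun d' (U : measurableType d') (f : T -> U) :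
  measurable_fun setT (f : T' -> U) -> measurable_fun setT f.
Proof. by move=> mf _ B mB; apply: sub; exact: (mf measurableT B mB). Qed.

Local Open Scope ereal_scope.

(* Both integrals are limits of the same combinations of the integrals of [f1],
   resp. [f2], over sets of the sub-sigma-algebra. *)
Lemma ge0_integralM_sub_eq (h f1 f2 : T -> R) :
  measurable_fun setT (h : T' -> R) -> (forall w, (0 <= h w)%R) ->
  measurable_fun setT f1 -> (forall w, (0 <= f1 w)%R) ->
  measurable_fun setT f2 -> (forall w, (0 <= f2 w)%R) ->
  (forall E, <<s gen>> E ->
    \int[P]_(w in E) (f1 w)%:E = \int[P]_(w in E) (f2 w)%:E) ->
  \int[P]_w ((h w)%:E * (f1 w)%:E) = \int[P]_w ((h w)%:E * (f2 w)%:E).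
Proof.
move=> mh h0 mf1 f10 mf2 f20 f12.
have mEh : measurable_fun [set: T'] (EFin \o (h : T' -> R)) by exact/measurable_EFinP.
pose g := nnsfun_approx measurableT mEh.
have mg n : measurable_fun setT (g n : T -> R).
  by apply: sub_measurable_fun; exact: measurable_funP.
have g_cvg x : (g n x)%:E @[n --> \oo] --> (h x)%:E.
  by apply: cvg_nnsfun_approx => // y _; rewrite lee_fin.
have key (r : T -> R) (f := EFin \o r) : measurable_fun setT r ->
    (forall w, (0 <= r w)%R) -> \int[P]_w ((h w)%:E * f w) = limn (fun n =>
    \sum_(y \in range (g n)) (y%:E * \int[P]_(w in g n @^-1` [set y]) f w)).
  move=> mr r0; have mf : measurable_fun setT f by exact/measurable_EFinP.
  have f0 w : 0 <= f w by rewrite lee_fin.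
  have -> : \int[P]_w ((h w)%:E * f w) = limn (fun n => \int[P]_w ((g n w)%:E * f w)).
    under eq_integral => w _.
      have -> : (h w)%:E * f w = limn (fun n => (g n w)%:E * f w).
        by apply/esym/cvg_lim => //; apply: cvgeZr => //; exact: g_cvg.
      over.
    apply: monotone_convergence => //.
    - move=> n; apply: emeasurable_funM => //; exact/measurable_EFinP.
    - by move=> n x _; rewrite mule_ge0 ?lee_fin.
    - move=> x _ a b ab; rewrite lee_wpmul2r ?lee_fin//.
      by have /lefP := nd_nnsfun_approx measurableT mEh ab; exact.
  congr (limn _); apply/funext => n.
  transitivity (\int[P]_w (\sum_(y \in range (g n))
      (y * \1_(g n @^-1` [set y]) w)%:E * f w)).
    apply: eq_integral => w _.
    rewrite -ge0_mule_fsuml => [|y]; last exact: nnfun_muleindic_ge0.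
    rewrite fsumEFin//; congr (_%:E * _); exact: (fimfunE (g n) w).
  have mA y : measurable (g n @^-1` [set y] : set T).
    by rewrite -[_ @^-1` _]setTI; exact: mg.
  rewrite ge0_integral_fsum//; last 2 first.
  - move=> y; apply: emeasurable_funM => //; apply/measurable_EFinP.
    by apply: measurable_funM => //; exact: measurable_indic.
  - by move=> y x _; rewrite mule_ge0 ?f0// nnfun_muleindic_ge0.
  apply: eq_fsbigr => y /set_mem[w0 _ yE].
  have y0 : (0 <= y)%R by rewrite -yE.
  under eq_integral do rewrite EFinM -muleA.
  rewrite ge0_integralZl//; last 2 first.
  - by apply: emeasurable_funM => //; apply/measurable_EFinP; exact: measurable_indic.
  - by move=> x _; rewrite mule_ge0 ?lee_fin.
  congr (_ * _); rewrite [RHS]integral_mkcond.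
  by apply: eq_integral => w _; rewrite epatch_indic muleC.
rewrite !key//; congr (limn _); apply/funext => n.
apply: eq_fsbigr => y _; congr (_ * _); apply: f12.
have mgn : measurable_fun [set: T'] (g n) by exact: measurable_funP.
by have := mgn measurableT _ (measurable_set1 y); rewrite setTI.
Qed.

End SubSigmaAlgebra.

Section RealIntegrals.
Context {R : realType} {d} {T : measurableType d} (P : probability T R).
Implicit Types (f g : T -> R) (E : set T).

Definition intg f := P.-integrable [set: T] (EFin \o f).

Lemma intg_measurable f : intg f -> measurable_fun setT f.
Proof. by move=> /integrableP[/measurable_EFinP]. Qed.

Lemma intg_le f g : measurable_fun setT f -> intg g ->
  (forall w, `|f w| <= g w) -> intg f.
Proof.
move=> mf ig fg; apply: le_integrable ig => //; first exact/measurable_EFinP.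
by move=> w _; rewrite /= lee_fin (le_trans (fg w))// ler_norm.
Qed.

Lemma intgD f g : intg f -> intg g -> intg (fun w => f w + g w).
Proof. by move=> fi gi; exact: (integrableD measurableT fi gi). Qed.

Lemma intgB f g : intg f -> intg g -> intg (fun w => f w - g w).
Proof. by move=> fi gi; exact: (integrableB measurableT fi gi). Qed.

Lemma intgZ c f : intg f -> intg (fun w => c * f w).
Proof. by move=> fi; exact: (integrableZl measurableT c fi). Qed.

Lemma intg_cst c : intg (fun=> c).
Proof. exact: finite_measure_integrable_cst. Qed.

Lemma intgS E f : measurable E -> intg f -> P.-integrable E (EFin \o f).
Proof. by move=> mE; exact: integrableS. Qed.

Lemma intg_sum n (f : 'I_n -> T -> R) : (forall i, intg (f i)) ->
  intg (fun w => \sum_i f i w).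
Proof.
move=> fi; rewrite /intg (_ : _ \o _ = fun w => (\sum_i (f i w)%:E)%E).
  by apply: integrable_sum => // i _; exact: fi.
by apply/funext => w; rewrite /= sumEFin.
Qed.

Lemma RintD E f g : measurable E -> intg f -> intg g ->
  \int[P]_(w in E) (f w + g w) = \int[P]_(w in E) f w + \int[P]_(w in E) g w.
Proof. by move=> mE fi gi; apply: RintegralD => //; exact: intgS. Qed.

Lemma RintB E f g : measurable E -> intg f -> intg g ->
  \int[P]_(w in E) (f w - g w) = \int[P]_(w in E) f w - \int[P]_(w in E) g w.
Proof. by move=> mE fi gi; apply: RintegralB => //; exact: intgS. Qed.

Lemma RintZ E c f : measurable E -> intg f ->
  \int[P]_(w in E) (c * f w) = c * \int[P]_(w in E) f w.
Proof. by move=> mE fi; apply: RintegralZl => //; exact: intgS. Qed.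

Lemma Rint_sum E n (f : 'I_n -> T -> R) : measurable E ->
  (forall i, intg (f i)) ->
  \int[P]_(w in E) (\sum_i f i w) = \sum_i \int[P]_(w in E) f i w.
Proof.
move=> mE; elim: n f => [|n IH] f fi.
  under eq_Rintegral do rewrite big_ord0.
  by rewrite big_ord0 Rintegral_cst// mul0r.
under eq_Rintegral do rewrite big_ord_recl.
rewrite RintD ?IH ?big_ord_recl//; first exact: intg_sum.
Qed.

Lemma Rint_le E f g : measurable E -> intg f -> intg g ->
  (forall w, f w <= g w) -> \int[P]_(w in E) f w <= \int[P]_(w in E) g w.
Proof. by move=> mE fi gi fg; apply: le_Rintegral => //; exact: intgS. Qed.

Lemma Rint_ge0 E f : (forall w, 0 <= f w) -> 0 <= \int[P]_(w in E) f w.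
Proof. by move=> f0; exact: Rintegral_ge0. Qed.

Lemma EFin_Rint E f : measurable E -> intg f ->
  (\int[P]_(w in E) f w)%:E = (\int[P]_(w in E) (f w)%:E)%E.
Proof.
by move=> mE fi; rewrite /Rintegral fineK//; apply: integrable_fin_num => //; exact: intgS.
Qed.

Lemma ge0_intg f r : measurable_fun setT f -> (forall w, 0 <= f w) ->
  (\int[P]_w (f w)%:E <= r%:E)%E -> intg f.
Proof.
move=> mf f0 fr; apply/integrableP; split; first exact/measurable_EFinP.
under eq_integral do rewrite /= ger0_norm//.
exact: le_lt_trans fr (ltry _).
Qed.

Variable gen : set (set T).
Hypothesis sub : <<s gen>> `<=` (measurable : set (set T)).

Local Notation T' := (g_sigma_algebraType gen).

(** By hypothesis the positive and negative parts of [Z] have equal integrals over the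
    sub-sigma-algebra, so the nonnegative case applies to each part of [h]. All four products are
    dominated by |h Z|, which allows the subtractions. *)
Lemma cond_mean0_mul (h Z : T -> R) : measurable_fun setT (h : T' -> R) ->
  intg Z -> intg (fun w => h w * Z w) ->
  (forall E, <<s gen>> E -> \int[P]_(w in E) Z w = 0) ->
  \int[P]_w (h w * Z w) = 0.
Proof.
move=> mh iZ ihZ Z0.
pose pos (f : T -> R) w := Num.max (f w) 0.
pose neg (f : T -> R) w := Num.max (- f w) 0.
have pos0 f w : 0 <= pos f w by rewrite le_max lexx orbT.
have neg0 f w : 0 <= neg f w by rewrite le_max lexx orbT.
have pos_le f w : pos f w <= `|f w| by rewrite ge_max ler_norm normr_ge0.
have neg_le f w : neg f w <= `|f w| by rewrite ge_max -normrN ler_norm normr_ge0.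
have posneg f w : f w = pos f w - neg f w.
  by rewrite /pos /neg /Order.max; do 2 case: ifPn; rewrite -?leNgt; lra.
have mpos' : measurable_fun setT (pos h : T' -> R) by apply: measurable_maxr.
have mneg' : measurable_fun setT (neg h : T' -> R).
  by apply: measurable_maxr => //; exact: measurableT_comp.
have mpos f : measurable_fun setT f -> measurable_fun setT (pos f).
  by move=> mf; apply: measurable_maxr.
have mneg f : measurable_fun setT f -> measurable_fun setT (neg f).
  by move=> mf; apply: measurable_maxr => //; exact: measurableT_comp.
have mZ := intg_measurable iZ.
have mh_ : measurable_fun setT h by exact: (sub_measurable_fun sub).
have ipZ : intg (pos Z).
  apply: (intg_le (g := fun w => `|Z w|)) => //; [exact: mpos | exact: integrable_norm |].
  by move=> w; rewrite ger0_norm.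
have inZ : intg (neg Z).
  apply: (intg_le (g := fun w => `|Z w|)) => //; [exact: mneg | exact: integrable_norm |].
  by move=> w; rewrite ger0_norm.
have eqZ E : <<s gen>> E ->
    (\int[P]_(w in E) (pos Z w)%:E = \int[P]_(w in E) (neg Z w)%:E)%E.
  move=> GE; have mE := sub GE; rewrite -!EFin_Rint//; congr EFin.
  apply/eqP; rewrite -subr_eq0 -RintB// -[X in _ == X](Z0 E GE); apply/eqP.
  by apply: eq_Rintegral => w _; rewrite -posneg.
have iprod (f g : T -> R) : measurable_fun setT f -> measurable_fun setT g ->
    (forall w, 0 <= f w) -> (forall w, 0 <= g w) ->
    (forall w, f w <= `|h w|) -> (forall w, g w <= `|Z w|) ->
    intg (fun w => f w * g w).
  move=> mf mg f0 g0 fh gZ.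
  apply: (intg_le (g := fun w => `|h w * Z w|)).
  - exact: measurable_funM.
  - exact: (integrable_norm ihZ).
  - by move=> w; rewrite !normrM ler_pM// ger0_norm.
have prod0 (f : T -> R) : measurable_fun setT (f : T' -> R) ->
    (forall w, 0 <= f w) -> (forall w, f w <= `|h w|) ->
    \int[P]_w (f w * pos Z w) = \int[P]_w (f w * neg Z w).
  move=> mf f0 fh; have mf_ : measurable_fun setT f by exact: (sub_measurable_fun sub).
  apply: EFin_inj; rewrite !EFin_Rint//; try by apply: iprod => //; auto.
  under eq_integral do rewrite EFinM; under [RHS]eq_integral do rewrite EFinM.
  by apply: (ge0_integralM_sub_eq sub) => //; auto.
have E w : h w * Z w = pos h w * pos Z w - pos h w * neg Z w
   - (neg h w * pos Z w - neg h w * neg Z w).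
  by rewrite {1}(posneg h) {1}(posneg Z); ring.
under eq_Rintegral do rewrite E.
rewrite !RintB ?prod0 ?subrr//; try (apply: intgB); try by apply: iprod; auto.
Qed.

End RealIntegrals.

(** * Nonnegative supermartingales with vanishing mean *)

Section Supermartingale.
Context {R : realType} {d} {T : measurableType d} (P : probability T R).
Variable gen : nat -> set (set T).
Hypothesis sub : forall k, <<s gen k>> `<=` (measurable : set (set T)).
Hypothesis gen_mono : forall k, <<s gen k>> `<=` <<s gen k.+1>>.
Variables (Y : nat -> T -> R) (k0 : nat).
Hypotheses (Y0 : forall k w, 0 <= Y k w) (iY : forall k, intg P (Y k)).
Hypothesis mY : forall k,
  measurable_fun setT (Y k : g_sigma_algebraType (gen k) -> R).
Hypothesis superY : forall k E, (k0 <= k)%N -> <<s gen k>> E ->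
  \int[P]_(w in E) Y k.+1 w <= \int[P]_(w in E) Y k w.

Let below n c N : set T := [set w | forall j, (j < N)%N -> Y (n + j)%N w < c].

Let belowS n c N : below n c N.+1 = below n c N `&` [set w | Y (n + N)%N w < c].
Proof.
apply/seteqP; split=> w.
  by move=> h; split=> [j jN|]; apply: h => //; exact: leqW.
by move=> [h1 h2] j; rewrite ltnS leq_eqVlt => /orP[/eqP->|/h1].
Qed.

(** The event [below n c N.+1] looks at the times [n] to [n + N] inclusive, so it is known at time
    [n + N]. *)
Let below_gen n c N : <<s gen (n + N)%N>> (below n c N.+1).
Proof.
have lt k : <<s gen k>> [set w | Y k w < c].
  have := @mY k measurableT _ (measurable_itv `]-oo, c[).
  rewrite setTI (_ : _ @^-1` _ = [set w | Y k w < c]); first exact.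
  by apply/seteqP; split=> w; rewrite /= in_itv.
elim: N => [|N IH].
  rewrite belowS addn0 (_ : below n c 0 = setT) ?setTI//.
  by apply/seteqP; split=> w // _ j.
rewrite belowS.
apply: (@measurableI _ (g_sigma_algebraType (gen (n + N.+1)%N))); last exact: lt.
by rewrite addnS; apply: gen_mono.
Qed.

Let below_measurable n c N : measurable (below n c N).
Proof.
case: N => [|N]; last exact: (@sub (n + N)%N _ (@below_gen n c N)).
rewrite (_ : below n c 0 = setT)//.
by apply/seteqP; split=> w // _ j.
Qed.

Lemma maximal_inequality n c : (k0 <= n)%N -> 0 < c ->
  (P (\bigcup_j [set w | (c <= Y (n + j)%N w)%R]) <=
   (\int[P]_w Y n w / c)%:E)%E.
Proof.
move=> kn c0; set e := \int[P]_w Y n w.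
have iYc k : intg P (fun w => Y k w - c) by apply: intgB => //; exact: intg_cst.
(* Stopping in integrated form: paths leaving [below] at time [n + N] have [Y - c >= 0], so
   discarding them lowers the integral, and on the rest the supermartingale inequality applies. *)
have step N : \int[P]_(w in below n c N) (Y (n + N)%N w - c) + c <= e.
  elim: N => [|N IH].
    rewrite addn0 (_ : below n c 0 = setT); last first.
      by apply/seteqP; split=> w // _ j.
    rewrite RintB//; last exact: intg_cst.
    have P1 : fine (P [set: T]) = 1 by rewrite -[RHS]/(fine 1%:E) -(probability_setT P).
    by rewrite Rintegral_cst// [fine _]P1 mulr1 subrK.
  apply: le_trans IH; rewrite lerD2r.
  apply: (@le_trans _ _ (\int[P]_(w in below n c N.+1) (Y (n + N)%N w - c))).
    rewrite !RintB//; try exact: intg_cst.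
    by rewrite lerD2r addnS superY// (leq_trans kn)// leq_addr.
  rewrite [leLHS]Rintegral_mkcond [leRHS]Rintegral_mkcond.
  apply: Rint_le => //.
  - rewrite /intg -restrict_EFin.
    by apply: (iffLR (integrable_mkcond _ (below_measurable n c _))); apply: intgS.
  - rewrite /intg -restrict_EFin.
    by apply: (iffLR (integrable_mkcond _ (below_measurable n c _))); apply: intgS.
  - move=> w; rewrite belowS /patch in_setI.
    case: ifPn => /= [/andP[-> _]//|].
    rewrite negb_and; case: ifPn => //= _; rewrite notin_setE/= => /negP.
    by rewrite -leNgt subr_ge0.
have bnd N : (P (~` below n c N) <= (e / c)%:E)%E.
  rewrite probability_setC//.
  have -> : P (below n c N) = (fine (P (below n c N)))%:E.
    by rewrite fineK// fin_num_measure.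
  rewrite -EFinB lee_fin ler_pdivlMr//.
  have := step N; rewrite RintB//; last exact: intg_cst.
  rewrite Rintegral_cst//.
  have := Rint_ge0 P (below n c N) (Y0 (n + N)%N); lra.
have -> : \bigcup_j [set w | c <= Y (n + j)%N w] = \bigcup_N ~` below n c N.
  apply/seteqP; split=> w [j _ h].
    by exists j.+1 => // /(_ j (ltnSn _)); rewrite ltNge h.
  apply: contrapT => H; apply: h => i ij; rewrite ltNge; apply/negP => ci.
  by apply: H; exists i.
have cvgP : P (~` below n c N) @[N --> \oo] --> P (\bigcup_N ~` below n c N).
  apply: nondecreasing_cvg_mu => [N||].
  - by apply: measurableC.
  - by apply: bigcup_measurable => N _; exact: measurableC.
  - move=> N N' NN'; apply/subsetPset => w; apply: contra_not => h j jN.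
    exact: h (leq_trans jN NN').
rewrite -(cvg_lim _ cvgP)//; apply: lime_le; first by apply/cvg_ex; eexists; exact: cvgP.
exact: nearW.
Qed.

Hypothesis Ycvg : forall c, 0 < c -> exists2 n, (k0 <= n)%N & \int[P]_w Y n w <= c.

(** The event [bad c] says that [c] is reached after every starting time. Started at a time of small
    mean, the maximal inequality makes its probability arbitrarily small. *)
Lemma supermartingale_cvg0 : {ae P, forall w, Y k w @[k --> \oo] --> (0 : R)}.
Proof.
pose over c n := \bigcup_j [set w | c <= Y (n + j)%N w].
pose bad c := \bigcap_(n in [set n | (k0 <= n)%N]) over c n.
have mover c n : measurable (over c n).
  apply: bigcup_measurable => j _; apply: (@sub (n + j)%N).
  have := @mY (n + j)%N measurableT _ (measurable_itv `[c, +oo[).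
  rewrite setTI (_ : _ @^-1` _ = [set w | c <= Y (n + j)%N w]); first exact.
  by apply/seteqP; split=> w; rewrite /= in_itv/= andbT.
have mbad c : measurable (bad c).
  by apply: bigcap_measurableType => n _.
have bad0 c : 0 < c -> P (bad c) = 0%E.
  move=> c0; apply/eqP; rewrite eq_le measure_ge0 andbT.
  apply/lee_addgt0Pr => e e0; rewrite add0e.
  have [n kn hn] := Ycvg (mulr_gt0 e0 c0).
  apply: (@le_trans _ _ (P (over c n))).
    by apply: le_measure; rewrite ?inE//; exact: bigcap_inf.
  apply: (le_trans (maximal_inequality kn c0)).
  by rewrite lee_fin ler_pdivrMr.
have neg : P.-negligible (\bigcup_m bad m.+1%:R^-1).
  apply: negligible_bigcup => m; apply/negligibleP => //.
  by apply: bad0; rewrite invr_gt0.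
apply: (negligibleS _ neg) => w /= nc; apply: contrapT => H; apply: nc.
apply/cvgrPdist_lt => e e0.
pose m := Num.truncn e^-1.
have me : m.+1%:R^-1 < e.
  by rewrite invf_plt ?posrE// truncnS_gt.
have : ~ bad m.+1%:R^-1 w by move=> h; apply: H; exists m.
move=> /existsNP[n /not_implyP[kn hn]].
exists n => // k /= nk; rewrite sub0r normrN ger0_norm//.
apply: lt_trans me; rewrite ltNge; apply/negP => h.
by apply: hn; exists (k - n)%N => //=; rewrite subnKC.
Qed.

End Supermartingale.

(** [V] has no prescribed sign, so it is first replaced by its positive part, which [b >= 0] still
    dominates almost everywhere. *)
Lemma cond_exp_bound (R : realType) d (T : measurableType d) (P : probability T R)
    (G : set (set T)) (X b : T -> R) (V : T -> \bar R) E :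
  G `<=` (measurable : set (set T)) ->
  is_cond_exp P G (fun w => (X w)%:E) V -> (forall w, 0 <= b w) -> intg P b ->
  {ae P, forall w, (V w <= (b w)%:E)%E} -> G E ->
  (\int[P]_(w in E) (X w)%:E <= \int[P]_(w in E) (b w)%:E)%E.
Proof.
move=> GT [_ VG VE] b0 ib Vb GE; have mE := GT _ GE.
have mV : measurable_fun setT V by move=> _ B mB; rewrite setTI; exact/GT/VG.
rewrite -VE// integralE.
apply: (@le_trans _ _ (\int[P]_(w in E) V^\+ w)%E).
  rewrite -[leRHS]sube0; apply: leeB => //.
  by apply: integral_ge0 => w _; exact: funeneg_ge0.
apply: ae_ge0_le_integral => //.
- by apply: (measurable_funS measurableT) => //; exact: measurable_funepos.
- by move=> w _; rewrite lee_fin.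
- by apply: (measurable_funS measurableT) => //; apply/measurable_EFinP; exact: intg_measurable ib.
- apply: filterS Vb => w Vb _; rewrite funeposE ge_max Vb/= lee_fin; exact: b0.
Qed.

Lemma lipschitz_sq_continuous (R : realType) n p (F : 'cV[R]_n -> 'cV[R]_p) c :
  0 <= c -> (forall x y, sq (F x - F y) <= c * sq (x - y)) ->
  forall i, continuous (fun v => F v i 0).
Proof.
move=> c0 hF i x; apply/(@cvgrPdist_lt _ R^o _ (nbhs x)) => e e0.
have : (fun y => sq (x - y)) @ x --> (0 : R).
  rewrite -[X in _ --> X](dot0r (0 : 'cV[R]_n)) -(subrr x).
  apply: (cvg_comp (fun y => x - y) (fun u => sq u)).
    by apply: (@cvgB _ _ _ (nbhs x) _ (cst x) id); [exact: cvg_cst | exact: cvg_id].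
  exact: dot_continuous.
have r0 : 0 < e ^+ 2 / (c + 1) by rewrite divr_gt0 ?exprn_gt0// ltr_wpDl.
move=> /(cvgr_lt (0 : R))/(_ _ r0); apply: filterS => y hy.
rewrite -(ltr_pXn2r (n := 2))// ?nnegrE ?(ltW e0)// real_normK ?num_real//.
have := dot_coord (F x - F y) i; rewrite !mxE => h1.
apply: (le_lt_trans h1); apply: (le_lt_trans (hF x y)).
move: hy; rewrite ltr_pdivlMr ?ltr_wpDl// => hy.
by have := dot_ge0 (x - y); lra.
Qed.

Section Filtration.
Context {R : realType} {d} {T : measurableType d} (n : nat).
Variable M : nat -> T -> 'cV[R]_n.
Hypothesis mM : forall k j, measurable_fun [set: T] (fun w => M k.+1 w j 0).

(* [noise_sigma M k] is [<<s noise_gen k>>]; the name makes it available as the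
   measurable type [g_sigma_algebraType (noise_gen k)]. *)
Definition noise_gen k : set (set T) :=
  [set E | exists i j (B : set R), [/\ (1 <= i <= k)%N, measurable B &
         E = (fun w => M i w j 0) @^-1` B]].

Lemma noise_gen_sub k : <<s noise_gen k >> `<=` (measurable : set (set T)).
Proof.
apply: smallest_sub; first exact: sigma_algebra_measurable.
move=> _ [[|i] [j [B []]]] // _ mB ->.
by rewrite -[_ @^-1` _]setTI; exact: (@mM i j measurableT B mB).
Qed.

Lemma noise_gen_mono k : <<s noise_gen k >> `<=` <<s noise_gen k.+1 >>.
Proof.
apply: sub_sigma_algebra2 => _ [i [j [B [/andP[i1 ik] mB ->]]]].
by exists i, j, B; split => //; rewrite i1 leqW.
Qed.

Lemma noise_gen_measurable k j :
  measurable_fun setT (fun w : g_sigma_algebraType (noise_gen k.+1) => M k.+1 w j 0).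
Proof.
move=> _ B mB; rewrite setTI; apply: sub_sigma_algebra.
by exists k.+1, j, B; rewrite leqnn.
Qed.

Lemma gen_measurableS k (f : T -> R) :
  measurable_fun setT (f : g_sigma_algebraType (noise_gen k) -> R) ->
  measurable_fun setT (f : g_sigma_algebraType (noise_gen k.+1) -> R).
Proof. by move=> mf _ B mB; apply: noise_gen_mono; exact: (mf measurableT B mB). Qed.

End Filtration.

(** * The stochastic process *)

Section VectorMeasurable.
Context {R : realType} {d} {T : measurableType d}.

Definition vmeasurable n (u : T -> 'cV[R]_n) :=
  forall i, measurable_fun setT (fun w => u w i 0).

Lemma vmeasurableD n (u v : T -> 'cV[R]_n) :
  vmeasurable u -> vmeasurable v -> vmeasurable (fun w => u w + v w).
Proof.
move=> mu mv i; under eq_fun do rewrite mxE.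
by apply: measurable_funD; [exact: mu | exact: mv].
Qed.

Lemma vmeasurableN n (u : T -> 'cV[R]_n) :
  vmeasurable u -> vmeasurable (fun w => - u w).
Proof.
move=> mu i; under eq_fun do rewrite mxE.
by apply: measurableT_comp => //; exact: mu.
Qed.

Lemma vmeasurableZ n a (u : T -> 'cV[R]_n) :
  vmeasurable u -> vmeasurable (fun w => a *: u w).
Proof.
move=> mu i; under eq_fun do rewrite mxE.
by apply: measurable_funM; [exact: measurable_cst | exact: mu].
Qed.

Lemma vmeasurable_cst n (u : 'cV[R]_n) : vmeasurable (fun=> u).
Proof. by move=> i; exact: measurable_cst. Qed.

Lemma vmeasurable_mul n p (A : 'M[R]_(p, n)) (u : T -> 'cV[R]_n) :
  vmeasurable u -> vmeasurable (fun w => A *m u w).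
Proof.
move=> mu i; under eq_fun do rewrite mxE.
apply: measurable_sum => j.
by apply: measurable_funM; [exact: measurable_cst | exact: mu].
Qed.

Lemma vmeasurable_lipschitz n p (F : 'cV[R]_n -> 'cV[R]_p) c (u : T -> 'cV[R]_n) :
  0 <= c -> (forall x y, sq (F x - F y) <= c * sq (x - y)) ->
  vmeasurable u -> vmeasurable (fun w => F (u w)).
Proof.
move=> c0 hF mu i.
apply: (@continuous_measurable _ _ _ _ (fun v => F v i 0) u _ mu).
exact: lipschitz_sq_continuous c0 hF i.
Qed.

Lemma dot_measurable n (u v : T -> 'cV[R]_n) :
  vmeasurable u -> vmeasurable v -> measurable_fun setT (fun w => dot (u w) (v w)).
Proof.
move=> mu mv; apply: measurable_sum => i.
by apply: measurable_funM; [exact: mu | exact: mv].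
Qed.

End VectorMeasurable.

Section Process.
Context {R : realType} {d1 d2 : nat} (rho L : R) (X : set 'cV[R]_d1).
Variables (H0 : 'cV[R]_d1 -> R) (A : 'M[R]_(d2, d1)) (b0 : 'cV[R]_d2).
Variable (xh : 'cV[R]_d2 -> 'cV[R]_d1).
Hypotheses (rho0 : 0 < rho) (sH : supergradient rho H0 (grad H0)).
Hypotheses (L0 : 0 <= L) (lH : lipschitz_sq L (grad H0)).
Hypotheses (cX : convex_cV X) (clX : closed X).
Hypotheses (xh_in : forall l, X (xh l)) (xh_VI : forall l y, X y ->
  dot (grad H0 (xh l) - A^T *m l) (y - xh l) <= 0).
Variable ls : 'cV[R]_d2.
Hypothesis lsmin : forall l, dual H0 A b0 xh ls <= dual H0 A b0 xh l.
Variables (alpha_max Gam : R).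

Local Notation res := (residual A b0 xh).
Local Notation D := (dual H0 A b0 xh).

Context {d} {T : measurableType d} (P : probability T R).
Variables (c2 : R) (x0 : 'cV[R]_d1) (l0 : 'cV[R]_d2) (M : nat -> T -> 'cV[R]_d1).
Variables (x : nat -> T -> 'cV[R]_d1) (l : nat -> T -> 'cV[R]_d2) (al be : nat -> R).
Hypotheses (al_bnd : forall k, 0 < al k <= alpha_max) (be0 : forall k, 0 < be k).
Hypothesis be_al : forall k, be k ^+ 2 <= Gam * al k ^+ 3.
Hypotheses (x0E : forall w, x 0%N w = x0) (l0E : forall w, l 0%N w = l0).
Hypothesis xS : forall k w, x k.+1 w =
  proj X (x k w + al k *: (grad H0 (x k w) - A^T *m l k w + M k.+1 w)).
Hypothesis lS : forall k w, l k.+1 w = l k w + be k *: (A *m x k w - b0).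
Hypotheses (c20 : 0 < c2) (MN : martingale_noise P c2 M x l).

Local Notation gen k := (noise_gen M k).
Local Notation T' k := (g_sigma_algebraType (gen k)).

Let mM k j : measurable_fun [set: T] (fun w => M k.+1 w j 0).
Proof. by have [h _ _] := MN k; exact: h. Qed.

Let gen_sub k : <<s gen k >> `<=` (measurable : set (set T)).
Proof. exact: noise_gen_sub. Qed.

(** The state at time [k] is a function of the first [k] noises; the projection and the gradient are
    Lipschitz, hence preserve measurability. *)
Lemma state_measurable k :
  vmeasurable (x k : T' k -> _) /\ vmeasurable (l k : T' k -> _).
Proof.
elim: k => [|k [IHx IHl]].
  by split=> i; [under eq_fun do rewrite x0E | under eq_fun do rewrite l0E];
    exact: measurable_cst.
have mx : vmeasurable (x k : T' k.+1 -> _) by move=> i; apply: gen_measurableS; exact: IHx.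
have ml : vmeasurable (l k : T' k.+1 -> _) by move=> i; apply: gen_measurableS; exact: IHl.
have mMk : vmeasurable (M k.+1 : T' k.+1 -> _) by move=> i; exact: noise_gen_measurable.
have mg : vmeasurable ((fun w => grad H0 (x k w)) : T' k.+1 -> _).
  exact: (vmeasurable_lipschitz (T := T' k.+1) L0 lH mx).
have mA : vmeasurable ((fun w => A^T *m l k w) : T' k.+1 -> _).
  exact: (vmeasurable_mul (T := T' k.+1) _ ml).
split=> i.
- under eq_fun do rewrite xS.
  move: i; apply: (vmeasurable_lipschitz (T := T' k.+1) (c := 1) (F := proj X)) => //.
    move=> u v; rewrite mul1r; apply: proj_nonexpansive => //.
    by exists (xh ls).
  apply: (vmeasurableD (T := T' k.+1)) => //.
  apply: (vmeasurableZ (T := T' k.+1)).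
  apply: (vmeasurableD (T := T' k.+1)) => //.
  apply: (vmeasurableD (T := T' k.+1)) => //.
  exact: (vmeasurableN (T := T' k.+1)).
- under eq_fun do rewrite lS.
  move: i; apply: (vmeasurableD (T := T' k.+1)) => //.
  apply: (vmeasurableZ (T := T' k.+1)).
  apply: (vmeasurableD (T := T' k.+1)); last exact: vmeasurable_cst.
  exact: (vmeasurable_mul (T := T' k.+1)).
Qed.

Let err k w := sq (x k w - xh (l k w)).
Let mul k w := sq (l k w - ls).
Let gap k w := D (l k w) - D ls.
Let wt k w := 1 + err k w + mul k w.

Let xhl_measurable k : vmeasurable ((fun w => xh (l k w)) : T' k -> _).
Proof.
have [c c0 hc] := xhat_lip b0 rho0 sH xh_in xh_VI.
have [_ ml] := state_measurable k.
apply: (vmeasurable_lipschitz (T := T' k) (ltW c0) _ ml) => u v; exact: hc.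
Qed.

Lemma err_measurable k : measurable_fun setT (err k : T' k -> R).
Proof.
have [mx ml] := state_measurable k.
have m : vmeasurable ((fun w => x k w - xh (l k w)) : T' k -> _).
  apply: (vmeasurableD (T := T' k)) => //; exact: (vmeasurableN (T := T' k)).
exact: (dot_measurable (T := T' k)).
Qed.

Lemma mul_measurable k : measurable_fun setT (mul k : T' k -> R).
Proof.
have [mx ml] := state_measurable k.
have m : vmeasurable ((fun w => l k w - ls) : T' k -> _).
  apply: (vmeasurableD (T := T' k)) => //; exact: vmeasurable_cst.
exact: (dot_measurable (T := T' k)).
Qed.

Lemma gap_measurable k : measurable_fun setT (gap k : T' k -> R).
Proof.
have [_ ml] := state_measurable k.
apply: (measurable_funB (T := T' k)); last exact: measurable_cst.
apply: (@continuous_measurable _ _ (T' k) _ D (l k) _ ml).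
exact: (@dual_continuous _ _ _ _ _ _ _ b0 _ rho0 sH xh_in xh_VI).
Qed.

Let sub_fun k (f : T -> R) : measurable_fun setT (f : T' k -> R) -> measurable_fun setT f.
Proof. exact: (sub_measurable_fun (@gen_sub k)). Qed.

Let err_ge0 k w : 0 <= err k w. Proof. exact: dot_ge0. Qed.
Let mul_ge0 k w : 0 <= mul k w. Proof. exact: dot_ge0. Qed.

Lemma wt_intg k : intg P (err k) -> intg P (mul k) -> intg P (wt k).
Proof.
by move=> ia il; apply: (intgD (intgD (intg_cst P 1) ia) il).
Qed.

(** The factor of the noise in the linear term of [err_step], known at time [k]. *)
Let step_dir k w := x k w - xh (l k w) + al k *: (grad H0 (x k w) - grad H0 (xh (l k w))).

Let step_dir_measurable k : vmeasurable (step_dir k : T' k -> _).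
Proof.
have [mx ml] := state_measurable k; have mh := @xhl_measurable k.
have mg : vmeasurable ((fun w => grad H0 (x k w)) : T' k -> _).
  exact: (vmeasurable_lipschitz (T := T' k) L0 lH mx).
have mgh : vmeasurable ((fun w => grad H0 (xh (l k w))) : T' k -> _).
  exact: (vmeasurable_lipschitz (T := T' k) L0 lH mh).
apply: (vmeasurableD (T := T' k)).
  by apply: (vmeasurableD (T := T' k)) => //; exact: (vmeasurableN (T := T' k)).
apply: (vmeasurableZ (T := T' k)).
by apply: (vmeasurableD (T := T' k)) => //; exact: (vmeasurableN (T := T' k)).
Qed.

Let noise_sq_measurable k : measurable_fun setT (fun w => sq (M k.+1 w)).
Proof. by apply: dot_measurable => i; exact: mM. Qed.

(** Square integrability of the noise is derived: the conditional second moment of a nonnegative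
    variable could be infinite, but it is bounded by the state, integrable by hypothesis. *)
Lemma noise_sq_bound : exists2 C, 0 < C & forall k, intg P (err k) -> intg P (mul k) ->
  intg P (fun w => sq (M k.+1 w)) /\ forall E, <<s gen k >> E ->
  \int[P]_(w in E) sq (M k.+1 w) <= C * \int[P]_(w in E) wt k w.
Proof.
have [c c0 hc] := state_bound b0 rho0 sH xh_in xh_VI ls.
exists (c2 * c) => [|k ia il]; first exact: mulr_gt0.
have [_ _ [V [VM Vb]]] := MN k.
have [mx ml] := state_measurable k.
pose b w := c2 * (1 + enorm (x k w) ^+ 2 + enorm (l k w) ^+ 2).
have bE w : b w = c2 * (1 + sq (x k w) + sq (l k w)) by rewrite /b !enorm_sq.
have b0' w : 0 <= b w by rewrite bE mulr_ge0 ?(ltW c20)// !addr_ge0 ?dot_ge0.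
have bwt w : b w <= c2 * c * wt k w.
  by rewrite bE -mulrA ler_pM2l// hc.
have iwt := wt_intg ia il.
have mb : measurable_fun setT b.
  rewrite (_ : b = fun w => c2 * (1 + sq (x k w) + sq (l k w))); last exact/funext.
  apply: (sub_fun (k := k)).
  apply: (measurable_funM (T := T' k)); first exact: measurable_cst.
  apply: (measurable_funD (T := T' k)); last exact: (dot_measurable (T := T' k)).
  apply: (measurable_funD (T := T' k)); last exact: (dot_measurable (T := T' k)).
  exact: measurable_cst.
have ib : intg P b.
  apply: (intg_le mb (intgZ (c2 * c) iwt)) => w.
  by rewrite ger0_norm.
have key E : <<s gen k >> E ->
  (\int[P]_(w in E) (sq (M k.+1 w))%:E <= \int[P]_(w in E) (b w)%:E)%E.
  move=> GE; have := cond_exp_bound (@gen_sub k) VM b0' ib Vb GE.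
  by under eq_integral do rewrite enorm_sq.
have isM : intg P (fun w => sq (M k.+1 w)).
  apply: (ge0_intg (r := \int[P]_w b w)) => //.
    by move=> w; exact: dot_ge0.
  rewrite EFin_Rint//; apply: key; exact: (@measurableT _ (T' k)).
split=> // E GE; have mE := @gen_sub k _ GE.
apply: (@le_trans _ _ (\int[P]_(w in E) b w)).
  by rewrite -lee_fin !EFin_Rint// key.
by rewrite -RintZ//; apply: Rint_le => //; exact: intgZ.
Qed.

Lemma noise_cross k : intg P (err k) -> intg P (mul k) ->
  intg P (fun w => dot (step_dir k w) (M k.+1 w)) /\ forall E, <<s gen k >> E ->
  \int[P]_(w in E) dot (step_dir k w) (M k.+1 w) = 0.
Proof.
move=> ia il; have [C _ hC] := noise_sq_bound; have [isM _] := hC k ia il.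
have [_ HM _] := MN k.
have mu := @step_dir_measurable k.
have su w : sq (step_dir k w) <= (2 + 2 * al k ^+ 2 * L) * err k w.
  apply: (le_trans (dotD_le _ _)); rewrite dotZl dotZr.
  have := ler_wpM2l (sqr_ge0 (al k)) (lH (x k w) (xh (l k w))).
  rewrite /err; lra.
have isu : intg P (fun w => sq (step_dir k w)).
  apply: (intg_le _ (intgZ (2 + 2 * al k ^+ 2 * L) ia)) => [|w].
    apply: (sub_fun (k := k)); exact: (dot_measurable (T := T' k)).
  by rewrite ger0_norm ?dot_ge0.
have iM i : intg P (fun w => M k.+1 w i 0).
  apply: (intg_le (@mM k i) (intgD (intg_cst P 1) isM)) => w.
  have := dot_coord (M k.+1 w) i; rewrite -real_normK ?num_real//.
  by have := normr_ge0 (M k.+1 w i 0); nra.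
have iuM i : intg P (fun w => step_dir k w i 0 * M k.+1 w i 0).
  apply: (intg_le _ (intgD isu isM)) => [|w].
    apply: measurable_funM; last exact: mM.
    exact: (sub_fun (mu i)).
  rewrite normrM; have := dot_coord (M k.+1 w) i; have := dot_coord (step_dir k w) i.
  rewrite -(real_normK (num_real (step_dir k w i 0))) -(real_normK (num_real (M k.+1 w i 0))).
  move: `|_| `|_| => p q; have := sqr_ge0 (p - q); nra.
split=> [|E GE]; first exact: intg_sum.
have mE := @gen_sub k _ GE.
rewrite Rint_sum// big1// => i _.
(* The indicator of [E] joins the multiplier, which stays measurable for the past, so that an
   integral over the whole space remains. *)
pose h w := \1_E w * step_dir k w i 0.
have hE w : ((fun w => step_dir k w i 0 * M k.+1 w i 0) \_ E) w = h w * M k.+1 w i 0.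
  by rewrite /patch /h indicE; case: ifPn => _; rewrite ?mul1r ?mul0r.
rewrite Rintegral_mkcond; under eq_Rintegral do rewrite hE.
apply: (cond_mean0_mul (@gen_sub k)) => //.
- apply: (measurable_funM (T := T' k)); last exact: mu.
  exact: (@measurable_indic _ (T' k)).
- apply: (intg_le _ (integrable_norm (iuM i))) => [|w].
    apply: measurable_funM; last exact: mM.
    by apply: measurable_funM; [exact: measurable_indic | exact: (sub_fun (mu i))].
  rewrite /= /h indicE; case: (_ \in _); rewrite ?mul1r// !mul0r normr0; exact: normr_ge0.
- move=> F GF; have [_ _ /(_ F GF)] := HM i.
  rewrite integral0 /Rintegral => <-.
  by [].
Qed.

(** Integrability is propagated together with the inequalities, because the noise bounds at step [k]
    presuppose it. *)
Lemma state_step : exists2 C, 0 < C & forall k, intg P (err k) -> intg P (mul k) ->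
  [/\ intg P (err k.+1), intg P (mul k.+1) & forall E, <<s gen k >> E ->
    \int[P]_(w in E) err k.+1 w <= (1 - rho * al k) * \int[P]_(w in E) err k w
      + C * al k ^+ 2 * \int[P]_(w in E) wt k w /\
    \int[P]_(w in E) mul k.+1 w <= \int[P]_(w in E) mul k w
      + C * al k * \int[P]_(w in E) err k w
      + C * al k ^+ 2 * \int[P]_(w in E) wt k w].
Proof.
have [C1 C10 h1] := err_step rho0 sH L0 lH cX clX xh_in xh_VI lsmin alpha_max Gam.
have [C2 C20 h2] := multiplier_step rho0 sH xh_in xh_VI lsmin alpha_max Gam.
have [Cn Cn0 hn] := noise_sq_bound.
exists (C1 * (Cn + 1) + C2) => [|k ia il].
  by rewrite addr_gt0// mulr_gt0// ltr_wpDl// ltW.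
have [isM bM] := hn k ia il; have [iuM uM0] := noise_cross ia il.
have iwt := wt_intg ia il.
pose f w := (1 - rho * al k) * err k w
  + 2 * al k * (1 + rho * al k) * dot (step_dir k w) (M k.+1 w)
  + C1 * al k ^+ 2 * (sq (M k.+1 w) + wt k w).
pose g w := mul k w + C2 * al k * err k w + C2 * al k ^+ 2 * wt k w.
have ef w : err k.+1 w <= f w.
  by rewrite /err xS lS; exact: h1.
have mg w : mul k.+1 w <= g w.
  by rewrite /mul lS; apply: h2.
have if1 := intgZ (1 - rho * al k) ia.
have if2 := intgZ (2 * al k * (1 + rho * al k)) iuM.
have if3 := intgZ (C1 * al k ^+ 2) (intgD isM iwt).
have ig2 := intgZ (C2 * al k) ia; have ig3 := intgZ (C2 * al k ^+ 2) iwt.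
have if_ : intg P f := intgD (intgD if1 if2) if3.
have ig : intg P g := intgD (intgD il ig2) ig3.
have ie' : intg P (err k.+1).
  apply: (intg_le (sub_fun (err_measurable (k := k.+1))) if_) => w.
  by rewrite ger0_norm.
have im' : intg P (mul k.+1).
  apply: (intg_le (sub_fun (mul_measurable (k := k.+1))) ig) => w.
  by rewrite ger0_norm.
split=> // E GE; have mE := @gen_sub k _ GE.
have W0 : 0 <= \int[P]_(w in E) wt k w.
  by apply: Rint_ge0 => w; rewrite !addr_ge0.
have a2 : 0 <= al k ^+ 2 := sqr_ge0 _.
have a0 : 0 <= al k by have /andP[/ltW] := al_bnd k.
have A0 := Rint_ge0 P E (@err_ge0 k).
have h3 := mulr_ge0 (mulr_ge0 (ltW C20) a2) W0.
have h4 := mulr_ge0 (mulr_ge0 (mulr_ge0 (ltW C10) (addr_ge0 (ltW Cn0) ler01)) a2) W0.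
have h5 := mulr_ge0 (mulr_ge0 (mulr_ge0 (ltW C10) (addr_ge0 (ltW Cn0) ler01)) a0) A0.
split.
- apply: (le_trans (Rint_le mE ie' if_ ef)).
  rewrite RintD//; last exact: intgD.
  rewrite RintD// RintZ//.
  rewrite uM0// mulr0 addr0 (RintZ (1 - rho * al k) mE ia).
  have -> : \int[P]_(w in E) (C1 * al k ^+ 2 * (sq (M k.+1 w) + wt k w)) =
      C1 * al k ^+ 2 * (\int[P]_(w in E) sq (M k.+1 w) + \int[P]_(w in E) wt k w).
    by rewrite (RintZ (C1 * al k ^+ 2) mE (intgD isM iwt)) RintD.
  have := ler_wpM2l (mulr_ge0 (ltW C10) a2) (bM E GE); lra.
- apply: (le_trans (Rint_le mE im' ig mg)).
  rewrite RintD//; last exact: intgD.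
  by rewrite RintD// RintZ// (RintZ _ mE iwt); lra.
Qed.

Lemma state_intg k : intg P (err k) /\ intg P (mul k).
Proof.
have [C _ hC] := state_step.
elim: k => [|k [ia il]]; last by have [] := hC k ia il.
split.
  rewrite /intg (_ : _ \o _ = EFin \o cst (sq (x0 - xh l0))); first exact: intg_cst.
  by apply/funext => w; rewrite /= /err x0E l0E.
rewrite /intg (_ : _ \o _ = EFin \o cst (sq (l0 - ls))); first exact: intg_cst.
by apply/funext => w; rewrite /= /mul l0E.
Qed.

Let gap_ge0 k w : 0 <= gap k w. Proof. by rewrite subr_ge0. Qed.

Lemma gap_intg k : intg P (gap k).
Proof.
have [C C0 hC] := dual_gap_le rho0 sH xh_in xh_VI lsmin.
have [_ il] := state_intg k.
apply: (intg_le (sub_fun (gap_measurable (k := k))) (intgZ C il)) => w.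
by rewrite ger0_norm//; have [] := hC (l k w).
Qed.

Lemma residual_intg k : intg P (fun w => sq (res (l k w))).
Proof.
have [C C0 hC] := dual_gap_le rho0 sH xh_in xh_VI lsmin.
have m : vmeasurable ((fun w => res (l k w)) : T' k -> _).
  apply: (vmeasurableD (T := T' k)); last exact: vmeasurable_cst.
  exact: (vmeasurable_mul (T := T' k) A (@xhl_measurable k)).
apply: (intg_le _ (intgZ C (gap_intg k))) => [|w].
  by apply: (sub_fun (k := k)); exact: (dot_measurable (T := T' k)).
by rewrite ger0_norm ?dot_ge0//; have [] := hC (l k w).
Qed.

(** No fresh noise enters the multiplier update, so the inequality holds pathwise and [E] can be any
    measurable set. *)
Lemma gap_step : exists2 C, 0 < C & forall k E, measurable E ->
  \int[P]_(w in E) gap k.+1 w + be k / 2 * \int[P]_(w in E) sq (res (l k w))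
  <= \int[P]_(w in E) gap k w + C * be k * \int[P]_(w in E) err k w
     + C * be k ^+ 2 * \int[P]_(w in E) wt k w.
Proof.
have [C C0 hC] := dual_step rho0 sH xh_in xh_VI lsmin.
exists C => // k E mE; have [ia il] := state_intg k; have iwt := wt_intg ia il.
have ig := gap_intg k; have ig' := gap_intg k.+1; have ir := residual_intg k.
have i1 := intgZ (be k / 2) ir.
have i2 := intgZ (C * be k) ia; have i3 := intgZ (C * be k ^+ 2) iwt.
have h w : gap k.+1 w + be k / 2 * sq (res (l k w)) <=
    gap k w + C * be k * err k w + C * be k ^+ 2 * wt k w.
  by have := hC (be k) (x k w) (l k w) (be0 k); rewrite /gap lS /wt /err /mul; lra.
have := Rint_le mE (intgD ig' i1) (intgD (intgD ig i2) i3) h.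
rewrite (RintD mE ig' i1) (RintD mE (intgD ig i2) i3) (RintD mE ig i2).
by rewrite (RintZ (be k / 2) mE ir) (RintZ (C * be k) mE ia) (RintZ (C * be k ^+ 2) mE iwt).
Qed.

Let gen_T k : <<s gen k >> setT.
Proof. exact: (@measurableT _ (T' k)). Qed.

Let total b k w := 1 + b * err k w + mul k w.

Let total_intg b k : intg P (total b k).
Proof.
have [ia il] := state_intg k.
exact: (intgD (intgD (intg_cst P 1) (intgZ b ia)) il).
Qed.

Let total_ge0 b k w : 0 <= b -> 0 <= total b k w.
Proof. by move=> b0'; rewrite !addr_ge0// mulr_ge0. Qed.

Let wt_total b k E : measurable E -> 1 <= b ->
  \int[P]_(w in E) wt k w <= \int[P]_(w in E) total b k w.
Proof.
move=> mE b1; have [ia il] := state_intg k.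
apply: Rint_le => //; first exact: wt_intg.
by move=> w; rewrite /wt /total lerD2r lerD2l ler_peMl.
Qed.

(* The weight [b] is chosen so that the contraction of [err] absorbs the term of
   order [al] in the recursion of [mul]. *)
Lemma total_step : exists2 b, 1 <= b & exists2 G, 0 <= G & forall k E, <<s gen k >> E ->
  \int[P]_(w in E) total b k.+1 w <= (1 + G * al k ^+ 2) * \int[P]_(w in E) total b k w.
Proof.
have [C C0 hC] := state_step; pose b := 1 + C / rho.
have Cr : 0 <= C / rho by rewrite divr_ge0// ltW.
have b1 : 1 <= b by rewrite lerDl.
have b0' : 0 <= b := le_trans ler01 b1.
exists b => //; exists ((b + 1) * C).
  exact: mulr_ge0 (addr_ge0 b0' ler01) (ltW C0).
move=> k E GE; have [ia il] := state_intg k; have [ia' il'] := state_intg k.+1.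
have mE := @gen_sub k _ GE.
have tot j : \int[P]_(w in E) total b j w = \int[P]_(w in E) 1
    + b * \int[P]_(w in E) err j w + \int[P]_(w in E) mul j w.
  have [ja jl] := state_intg j.
  rewrite (RintD mE (intgD (intg_cst P 1) (intgZ b ja)) jl).
  by rewrite (RintD mE (intg_cst P 1) (intgZ b ja)) (RintZ b mE ja).
have [_ _ /(_ E GE)[h1 h2]] := hC k ia il.
have hW := @wt_total b k E mE b1.
have a0 : 0 <= al k by have /andP[/ltW] := al_bnd k.
have A0 := Rint_ge0 P E (@err_ge0 k).
have bC : C <= b * rho.
  rewrite /b mulrDl mul1r divfK ?gt_eqF//; have := ltW rho0; lra.
have h3 := ler_wpM2r (mulr_ge0 a0 A0) bC.
have h4 := ler_wpM2l b0' h1.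
have h5 := ler_wpM2l (mulr_ge0 (mulr_ge0 (addr_ge0 b0' ler01) (ltW C0)) (sqr_ge0 (al k))) hW.
have t1 := tot k; have t2 := tot k.+1; clearbody b; lra.
Qed.

(** The step sizes enter only through the properties below; [r] stands for 1/4 - eps and [kap] is
    one constant for all comparisons. *)
Variables (K1 r kap : R).
Hypotheses (K11 : 1 <= K1) (r0 : 0 < r) (r14 : r <= 1 / 4) (kap0 : 0 < kap).
Local Notation n_ k := (k%:R + K1).
Hypothesis al_discount : forall G, 0 <= G -> exists U : nat -> R, exists k0,
  [/\ forall k, 0 <= U k,
    forall c, 0 < c -> exists k1, forall k, (k1 <= k)%N -> U k <= c &
    forall k, (k0 <= k)%N -> (1 + U k.+1) * (1 + G * al k ^+ 2) <= 1 + U k].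
Hypothesis be_le_al : forall k, be k <= kap * al k.
Hypothesis al_le : forall k, al k <= kap * n_ k `^ (- (1 / 2)).
Hypothesis al_large : forall c, exists k0, forall k, (k0 <= k)%N -> c <= al k * n_ k.
Hypothesis be_large : forall k, n_ k `^ r <= kap * (be k * n_ k).
Hypothesis be_small : forall k, be k * n_ k `^ (- (1 / 2)) <= kap * ((n_ k)^-1 * n_ k `^ (- r)).
Hypothesis be_sq_small : forall k, be k ^+ 2 <= kap * ((n_ k)^-1 * n_ k `^ (- r)).

Let n_gt0 k : 0 < n_ k.
Proof. by rewrite ltr_wpDl// (lt_le_trans ltr01). Qed.

(** Multiplied by [1 + U k], the mean for the weight [b'] of [total_step] is nonincreasing from [k0]
    on. Any other weight [b] follows from [total b <= b * total b']. *)
Lemma total_bounded b : 1 <= b -> exists2 B, 0 <= B &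
  forall k, \int[P]_w total b k w <= B.
Proof.
move=> b1; have [b' b'1 [G G0 hG]] := total_step.
have [U [k0 [U0 _ hU]]] := al_discount G0.
have b'0 : 0 <= b' by lra.
pose v k := \int[P]_w total b' k w.
have v0 k : 0 <= v k by apply: Rint_ge0 => w; exact: total_ge0.
have vB : exists2 B, 0 <= B & forall k, v k <= B.
  exists ((1 + U k0) * v k0 + \sum_(j < k0) v j).
    by rewrite addr_ge0 ?mulr_ge0 ?addr_ge0// sumr_ge0.
  move=> k; have [kk|kk] := ltnP k k0.
    rewrite (bigD1 (Ordinal kk))//= addrCA lerDl.
    by rewrite !addr_ge0 ?mulr_ge0 ?addr_ge0// sumr_ge0.
  have h : (1 + U k) * v k <= (1 + U k0) * v k0.
    elim: k kk => [|k IH]; first by rewrite leqn0 => /eqP->.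
    rewrite leq_eqVlt => /orP[/eqP->//|]; rewrite ltnS => kk.
    apply: le_trans (IH kk).
    have h1 := hG k setT (@gen_T k); rewrite -!/(v _) in h1.
    have U1 : 0 <= 1 + U k.+1 by rewrite addr_ge0.
    apply: (le_trans (ler_wpM2l U1 h1)); rewrite mulrA.
    by rewrite ler_wpM2r// hU.
  have := mulr_ge0 (U0 k) (v0 k); have : 0 <= \sum_(j < k0) v j by rewrite sumr_ge0.
  lra.
have [B B0 hB] := vB; exists (b * B) => [|k]; first by rewrite mulr_ge0//; lra.
apply: (@le_trans _ _ (b * v k)); last by rewrite ler_wpM2l//; lra.
rewrite /v -RintZ//; apply: Rint_le => // [|w]; first exact: intgZ.
rewrite /total !mulrDr mulr1 mulrA.
rewrite !lerD// ?ler_peMl//.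
by rewrite ler_wpM2r// ler_peMr//; lra.
Qed.

(** The forcing of order al^2 is the contraction rate [rho * al k] times O(n^(-1/2)), and al n tends
    to infinity, so the recursion can follow n^(-1/2). *)
Lemma err_rate : exists2 B, 0 <= B &
  forall k, \int[P]_w err k w <= B * n_ k `^ (- (1 / 2)).
Proof.
have [C C0 hC] := state_step; have [W W0 hW] := total_bounded (lexx 1).
have half0 : 0 < 1 / 2 :> R by [].
have rk0 : 0 < (rho * kap)^-1 by rewrite invr_gt0 mulr_gt0.
have [k1 hk1] := powR_shift_small K11 half0 rk0.
have [k2 hk2] := al_large rho^-1.
have C1 : 0 <= C * kap * W / rho.
  by rewrite divr_ge0 ?(ltW rho0)// !mulr_ge0// ltW.
apply: (@recursion_rate _ _ K11 (1 / 2) (C * kap * W / rho) (maxn k1 k2) (fun k => rho * al k)) => //.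
move=> k; rewrite geq_max => /andP[kk1 kk2].
have /andP[a0 _] := al_bnd k.
split.
- rewrite mulr_ge0 ?(ltW rho0) ?(ltW a0)//=.
  have h := le_trans (al_le k) (ler_wpM2l (ltW kap0) (hk1 k kk1)).
  apply: (le_trans (ler_wpM2l (ltW rho0) h)).
  by rewrite mulrA mulfV// gt_eqF// mulr_gt0.
- have := ler_wpM2l (ltW rho0) (hk2 k kk2); rewrite mulfV ?gt_eqF//; lra.
- have [ia il] := state_intg k.
  have [_ _ /(_ setT (@gen_T k))[h _]] := hC k ia il.
  apply: (le_trans h); rewrite lerD2l.
  have hw : \int[P]_w wt k w <= W.
    exact: le_trans (wt_total k measurableT (lexx 1)) (hW k).
  have -> : C * kap * W / rho * (rho * al k) * n_ k `^ (- (1 / 2)) =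
     C * al k * (kap * n_ k `^ (- (1 / 2))) * W by field; rewrite gt_eqF.
  apply: ler_pM => //; first by rewrite mulr_ge0 ?sqr_ge0 ?ltW.
    by apply: Rint_ge0 => w; rewrite !addr_ge0.
  by rewrite expr2 mulrA ler_wpM2l ?al_le// mulr_ge0// ltW.
Qed.

Lemma gap_rate : exists2 B, 0 <= B &
  forall k, \int[P]_w gap k w <= B * n_ k `^ (- r).
Proof.
have [C C0 hC] := gap_step; have [W W0 hW] := total_bounded (lexx 1).
have [B B0 hB] := err_rate.
(* Then [be k * t k] is 1/n, a contraction fast enough for n^(-r) since [2 * r <= 1], and the cost
   be t^2 = t/n is of order n^(-1) n^(-r). *)
pose t k := (be k * n_ k)^-1.
pose C' := kap * W / 2 + C * kap * B + C * kap * W.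
have C'0 : 0 <= C' by rewrite !addr_ge0// ?divr_ge0 ?mulr_ge0 ?(ltW kap0) ?(ltW C0).
apply: (@recursion_rate _ _ K11 r C' 0%N (fun k => (n_ k)^-1)) => //; first exact: ltW.
move=> k _; have N0 := n_gt0 k; have N1 : 1 <= n_ k by rewrite ler_wpDl.
have i0 : 0 < (n_ k)^-1 by rewrite invr_gt0.
have X0 : 0 <= n_ k `^ (- r) := powR_ge0 _ _.
split.
- by rewrite ltW//= invf_le1.
- rewrite mulVf ?gt_eqF// -ler_pdivlMl//; apply: (le_trans r14); lra.
have [ia il] := state_intg k; have ig := gap_intg k; have ir := residual_intg k.
have t0 : 0 < t k by rewrite invr_gt0 mulr_gt0.
have bt : be k * t k = (n_ k)^-1 by rewrite /t invfM mulrA mulfV ?mul1r// gt_eqF.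
have tk : t k <= kap * n_ k `^ (- r).
  rewrite /t powRN -ler_pdivrMr ?invr_gt0 ?powR_gt0// invrK mulrC.
  by rewrite ler_pdivrMr ?mulr_gt0.
have h1 := hC k setT measurableT.
have h2 : 2 * t k * \int[P]_w gap k w - t k ^+ 2 * \int[P]_w mul k w
    <= \int[P]_w sq (res (l k w)).
  have i1 := intgZ (2 * t k) ig; have i2 := intgZ (t k ^+ 2) il.
  rewrite -(RintZ (2 * t k) measurableT ig) -(RintZ (t k ^+ 2) measurableT il).
  rewrite -(RintB measurableT i1 i2); apply: Rint_le => //; first exact: intgB.
  by move=> w; exact: (residual_ge b0 rho0 sH xh_in xh_VI ls (l k w) t0).
have hw : \int[P]_w wt k w <= W.
  exact: le_trans (wt_total k measurableT (lexx 1)) (hW k).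
have hl : \int[P]_w mul k w <= W.
  apply: le_trans hw; apply: Rint_le => //; first exact: wt_intg.
  by move=> w; rewrite /wt ler_wpDl// addr_ge0.
move: (hB k) hw hl h1 h2; move: (\int[P]_w gap k.+1 w) (\int[P]_w gap k w).
move: (\int[P]_w sq _) (\int[P]_w err k w) (\int[P]_w wt k w) (\int[P]_w mul k w).
move=> S e w m g' g he hw hm h1 h2.
set Z := n_ k `^ (- r) in X0 tk *; set Y := (n_ k)^-1 in i0 bt *.
have h3 : be k / 2 * (2 * t k * g - t k ^+ 2 * m) <= be k / 2 * S.
  by rewrite ler_wpM2l// divr_ge0// ltW.
have E3 : be k / 2 * (2 * t k * g - t k ^+ 2 * m) = Y * g - Y / 2 * (t k * m).
  by rewrite -bt; field.
have h4 : t k * m <= kap * Z * W.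
  apply: (@le_trans _ _ (t k * W)); first by rewrite ler_wpM2l// ltW.
  by rewrite ler_wpM2r.
have h5 : Y / 2 * (t k * m) <= Y / 2 * (kap * Z * W).
  by rewrite ler_wpM2l// divr_ge0// ltW.
have h6 : C * be k * e <= C * kap * B * (Y * Z).
  apply: (@le_trans _ _ (C * be k * (B * n_ k `^ (- (1 / 2))))).
    by rewrite ler_wpM2l// mulr_ge0// ltW.
  have := ler_wpM2l (mulr_ge0 (ltW C0) B0) (be_small k); rewrite -/Z -/Y; lra.
have h7 : C * be k ^+ 2 * w <= C * kap * W * (Y * Z).
  apply: (@le_trans _ _ (C * be k ^+ 2 * W)).
    by rewrite ler_wpM2l// mulr_ge0 ?sqr_ge0// ltW.
  have := ler_wpM2l (mulr_ge0 (ltW C0) W0) (be_sq_small k); rewrite -/Z -/Y; lra.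
rewrite E3 in h3; rewrite /C'; lra.
Qed.

Lemma lyapunov_cvg0 : {ae P, forall w,
  err k w @[k --> \oo] --> (0 : R) /\ gap k w @[k --> \oo] --> (0 : R)}.
Proof.
have [Cs Cs0 hs] := state_step; have [Cg Cg0 hg] := gap_step.
have [b b1 [G G0 hG]] := total_step; have [W W0 hW] := total_bounded b1.
have [Be Be0 hBe] := err_rate; have [Bg Bg0 hBg] := gap_rate.
(* With this weight the contraction [b' * rho * al k] of [err] pays for the term [Cg * be k] in the
   recursion of [gap], as [be k <= kap * al k]. *)
pose b' := Cg * kap / rho.
have b'0 : 0 < b' by rewrite divr_gt0// mulr_gt0.
(* The first summand is the growth of [total], the others the remainders of [gap] and [err]. In the
   inequality for [1 + U], the 1 makes [U] drop enough to pay for these additive remainders. *)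
pose G2 := G + Cg * kap ^+ 2 + b' * Cs.
have G20 : 0 <= G2 := addr_ge0 (addr_ge0 G0 (mulr_ge0 (ltW Cg0) (sqr_ge0 kap)))
  (mulr_ge0 (ltW b'0) (ltW Cs0)).
have [U [k0 [U0 Uc hU]]] := al_discount G20.
pose Y k w := gap k w + b' * err k w + U k * total b k w.
have b0' : 0 <= b by lra.
have Y0 k w : 0 <= Y k w.
  apply: addr_ge0; last by apply: mulr_ge0 => //; exact: total_ge0.
  by apply: addr_ge0 => //; apply: mulr_ge0 => //; exact: ltW.
have iY k : intg P (Y k).
  have [ia il] := state_intg k.
  exact: (intgD (intgD (gap_intg k) (intgZ b' ia)) (intgZ (U k) (total_intg b k))).
have YE k E : measurable E -> \int[P]_(w in E) Y k w = \int[P]_(w in E) gap k w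
    + b' * \int[P]_(w in E) err k w + U k * \int[P]_(w in E) total b k w.
  move=> mE; have [ia il] := state_intg k.
  have i1 := intgZ b' ia; have i2 := intgZ (U k) (total_intg b k).
  rewrite (RintD mE (intgD (gap_intg k) i1) i2) (RintD mE (gap_intg k) i1).
  by rewrite (RintZ b' mE ia) (RintZ (U k) mE (total_intg b k)).
have mY k : measurable_fun setT (Y k : T' k -> R).
  have me := err_measurable (k := k); have mm := mul_measurable (k := k).
  apply: (measurable_funD (T := T' k)).
    apply: (measurable_funD (T := T' k)); first exact: gap_measurable.
    by apply: (measurable_funM (T := T' k)) => //; exact: measurable_cst.
  apply: (measurable_funM (T := T' k)); first exact: measurable_cst.
  apply: (measurable_funD (T := T' k)) => //.
  apply: (measurable_funD (T := T' k)); first exact: measurable_cst.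
  by apply: (measurable_funM (T := T' k)) => //; exact: measurable_cst.
have sY k E : (k0 <= k)%N -> <<s gen k >> E ->
    \int[P]_(w in E) Y k.+1 w <= \int[P]_(w in E) Y k w.
  move=> kk GE; have mE := @gen_sub k _ GE.
  have [ia il] := state_intg k.
  have [_ _ /(_ E GE)[h1 _]] := hs k ia il.
  have h2 := hg k E mE; have h3 := hG k E GE; have h4 := hU k kk.
  have hw := @wt_total b k E mE b1.
  have S0 : 0 <= \int[P]_(w in E) sq (res (l k w)).
    by apply: Rint_ge0 => w; exact: dot_ge0.
  have e0 := Rint_ge0 P E (@err_ge0 k).
  have t0 : 0 <= \int[P]_(w in E) total b k w.
    by apply: Rint_ge0 => w; exact: total_ge0.
  have /andP[a0 _] := al_bnd k.
  rewrite !YE//; move: h1 h2 h3 hw S0 e0 t0.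
  move: (\int[P]_(w in E) gap k.+1 w) (\int[P]_(w in E) gap k w).
  move: (\int[P]_(w in E) err k.+1 w) (\int[P]_(w in E) err k w).
  move: (\int[P]_(w in E) total b k.+1 w) (\int[P]_(w in E) total b k w).
  move: (\int[P]_(w in E) sq _) (\int[P]_(w in E) wt k w).
  move=> S w v' v e' e g' g h1 h2 h3 hw S0 e0 v0.
  have p1 := mulr_ge0 (divr_ge0 (ltW (be0 k)) (ler0n R 2)) S0.
  have p2 : Cg * be k * e <= b' * rho * al k * e.
    rewrite /b' divfK ?gt_eqF// -mulrA -[leRHS]mulrA -[leRHS]mulrA.
    by rewrite ler_pM2l// mulrA ler_wpM2r.
  have p3 : be k ^+ 2 <= kap ^+ 2 * al k ^+ 2.
    have ka : 0 <= kap * al k by rewrite mulr_ge0 ?(ltW kap0) ?(ltW a0).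
    by rewrite -exprMn ler_pXn2r// nnegrE ltW.
  have w0 : 0 <= al k ^+ 2 * v by rewrite mulr_ge0 ?sqr_ge0.
  have p4 : Cg * be k ^+ 2 * w <= Cg * kap ^+ 2 * al k ^+ 2 * v.
    apply: (@le_trans _ _ (Cg * be k ^+ 2 * v)).
      by rewrite ler_wpM2l// (mulr_ge0 (ltW Cg0) (sqr_ge0 _)).
    by rewrite ler_wpM2r// -mulrA ler_pM2l.
  have p5 : b' * (Cs * al k ^+ 2 * w) <= b' * (Cs * al k ^+ 2 * v).
    by rewrite ler_pM2l// ler_wpM2l// (mulr_ge0 (ltW Cs0) (sqr_ge0 _)).
  have p6 := ler_wpM2l (U0 k.+1) h3.
  have p7 := ler_wpM2r v0 h4.
  have p8 := ler_wpM2l (ltW b'0) h1.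
  have p9 : 0 <= U k.+1 * (Cg * kap ^+ 2 + b' * Cs) * (al k ^+ 2 * v).
    apply: mulr_ge0 => //; apply: mulr_ge0 => //; apply: addr_ge0.
      exact: mulr_ge0 (ltW Cg0) (sqr_ge0 kap).
    exact: mulr_ge0 (ltW b'0) (ltW Cs0).
  have p10 := mulr_ge0 G0 w0.
  by move: p2 p5 p7 p8 p9 p10; rewrite /G2; clearbody b'; lra.
have Ycvg c : 0 < c -> exists2 n, (k0 <= n)%N & \int[P]_w Y n w <= c.
  move=> c0; have r2 : 0 < 1 / 2 :> R by [].
  have e1 : 0 < c / 3 / (Bg + 1) by rewrite divr_gt0 ?divr_gt0// ltr_wpDl.
  have e2 : 0 < c / 3 / (b' * Be + 1).
    by rewrite divr_gt0 ?divr_gt0// ltr_wpDl// mulr_ge0// ltW.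
  have e3 : 0 < c / 3 / (W + 1) by rewrite divr_gt0 ?divr_gt0// ltr_wpDl.
  have [k1 h1] := powR_shift_small K11 r0 e1.
  have [k2 h2] := powR_shift_small K11 r2 e2.
  have [k3 h3] := Uc _ e3.
  pose n := (k0 + k1 + k2 + k3)%N; exists n; first by rewrite /n -!addnA leq_addr.
  rewrite YE// (_ : c = c / 3 + c / 3 + c / 3); last by field.
  have s1 a B : 0 <= a -> 0 <= B -> a <= c / 3 / (B + 1) -> B * a <= c / 3.
    move=> a0 B0; rewrite ler_pdivlMr ?ltr_wpDl// => h; apply: le_trans h.
    by rewrite mulrC ler_wpM2l// lerDl.
  apply: lerD; first apply: lerD.
  - apply: (le_trans (hBg n)); apply: s1 => //; first exact: powR_ge0.
    by apply: h1; rewrite /n -!addnA addnCA leq_addr.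
  - apply: (@le_trans _ _ (b' * (Be * n_ n `^ (- (1 / 2))))).
      by rewrite ler_wpM2l// ltW.
    rewrite mulrA; apply: s1; [exact: powR_ge0 | by rewrite mulr_ge0// ltW |].
    by apply: h2; rewrite /n addnAC leq_addl.
  - apply: (@le_trans _ _ (U n * W)); first by rewrite ler_wpM2l.
    by rewrite mulrC; apply: s1 => //; apply: h3; rewrite /n leq_addl.
have := supermartingale_cvg0 (@gen_sub) (@noise_gen_mono _ _ _ _ M) Y0 iY mY sY Ycvg.
apply: filterS => w Yw; split.
- have h : (b'^-1 * Y k w) @[k --> \oo] --> (0 : R).
    by rewrite -(mulr0 b'^-1); apply: cvgM => //; exact: cvg_cst.
  apply: (squeeze_cvgr _ (cvg_cst 0) h); apply: nearW => k.
  rewrite err_ge0/= ler_pdivlMl// /Y -addrA addrCA lerDl addr_ge0//.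
  by rewrite mulr_ge0// total_ge0.
- apply: (squeeze_cvgr _ (cvg_cst 0) Yw); apply: nearW => k.
  rewrite gap_ge0/= /Y -addrA lerDl addr_ge0//.
    by rewrite mulr_ge0// ltW.
  by rewrite mulr_ge0// total_ge0.
Qed.

Let expect_le (f : T -> R) c : intg P f -> \int[P]_w f w <= c ->
  ('E_P[f] <= c%:E)%E.
Proof. by move=> i_f fc; rewrite unlock -EFin_Rint ?lee_fin. Qed.

Lemma err_as_cvg0 : {ae P, forall w,
  enorm (x k w - xh (l k w)) @[k --> \oo] --> (0 : R)}.
Proof.
apply: filterS lyapunov_cvg0 => w [ew _]; apply/cvgrPdist_lt => e e0.
have e2 : 0 < e ^+ 2 by rewrite exprn_gt0.
move: ew => /(cvgr_lt (0 : R))/(_ _ e2); apply: filterS => k.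
rewrite /err -enorm_sq sub0r normrN ger0_norm ?enorm_ge0//.
by rewrite ltr_pXn2r// nnegrE ?enorm_ge0// ltW.
Qed.

Lemma constraint_as_cvg : {ae P, forall w, A *m x k w @[k --> \oo] --> b0}.
Proof.
have [C C0 hC] := constraint_le rho0 sH xh_in xh_VI lsmin.
apply: filterS lyapunov_cvg0 => w [ew gw].
apply/(@cvgrPdist_lt _ _ _ \oo) => e e0.
have e2 : 0 < e ^+ 2 / 2 / C by rewrite !divr_gt0 ?exprn_gt0.
have ek : \forall k \near \oo, err k w < e ^+ 2 / 2 / C.
  by apply: cvgr_lt e2; exact: ew.
have gk : \forall k \near \oo, gap k w < e ^+ 2 / 2 / C.
  by apply: cvgr_lt e2; exact: gw.
apply: filterS2 ek gk => k ek gk.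
rewrite -normrN opprB; apply: norm_lt_dot => //.
apply: (le_lt_trans (hC (x k w) (l k w))); rewrite -/(err k w) -/(gap k w).
rewrite mulrC -ltr_pdivlMr//.
have -> : e ^+ 2 / C = e ^+ 2 / 2 / C + e ^+ 2 / 2 / C by field; rewrite gt_eqF.
exact: ltrD.
Qed.

Lemma err_mean_rate : exists2 B, 0 <= B & forall k,
  ('E_P[(fun w => enorm (x k w - xh (l k w)) ^+ 2)%R]
     <= (B * n_ k `^ (- (1 / 2)))%:E)%E.
Proof.
have [B B0 hB] := err_rate; exists B => // k; have [ia _] := state_intg k.
rewrite (_ : (fun w => _) = err k); last by apply/funext => w; rewrite enorm_sq.
exact: expect_le.
Qed.

Lemma constraint_mean_rate : exists2 B, 0 <= B & forall k,
  ('E_P[(fun w => enorm (A *m x k w - b0) ^+ 2)%R] <= (B * n_ k `^ (- r))%:E)%E.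
Proof.
have [C C0 hC] := constraint_le rho0 sH xh_in xh_VI lsmin.
have [Be Be0 hBe] := err_rate; have [Bg Bg0 hBg] := gap_rate.
exists (C * (Be + Bg)) => [|k]; first by rewrite mulr_ge0 ?(ltW C0)// addr_ge0.
rewrite (_ : (fun w => _) = (fun w => sq (A *m x k w - b0))); last first.
  by apply/funext => w; rewrite enorm_sq.
have [ia _] := state_intg k; have ig := gap_intg k.
have m : vmeasurable ((fun w => A *m x k w - b0) : T' k -> _).
  have [mx _] := state_measurable k.
  apply: (vmeasurableD (T := T' k)); last exact: vmeasurable_cst.
  exact: (vmeasurable_mul (T := T' k) A mx).
have ir : intg P (fun w => sq (A *m x k w - b0)).
  apply: (intg_le _ (intgZ C (intgD ia ig))) => [|w].
    by apply: (sub_fun (k := k)); exact: (dot_measurable (T := T' k)).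
  by rewrite ger0_norm ?dot_ge0//; exact: hC.
apply: expect_le => //.
have h : \int[P]_w sq (A *m x k w - b0) <= C * (\int[P]_w err k w + \int[P]_w gap k w).
  rewrite -(RintD measurableT ia ig) -(RintZ C measurableT (intgD ia ig)).
  by apply: Rint_le => // [|w]; [apply: intgZ; exact: intgD | exact: hC].
apply: (le_trans h); rewrite -mulrA ler_pM2l// mulrDl; apply: lerD => //.
apply: (le_trans (hBe k)); rewrite ler_wpM2l// ler_powR//.
  by rewrite ler_wpDl.
rewrite lerN2; apply: (le_trans r14).
by rewrite ler_pM2l// lef_pV2 ?posrE// ler_nat.
Qed.

End Process.

(** * Step sizes and conclusion *)

Section StepSizes.
Context {R : realType} (eps alpha beta K1 : R).
Hypotheses (eps0 : 0 < eps) (eps14 : eps < 1 / 4).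
Hypotheses (al0 : 0 < alpha) (be0 : 0 < beta).
Hypothesis K11 : 1 <= K1.

Local Notation n_ k := (k%:R + K1).

Definition fast_step k := alpha / n_ k `^ (1 / 2 + 66 / 100 * eps).
Definition slow_step k := beta / n_ k `^ (3 / 4 + eps).

Let n_ge1 k : 1 <= n_ k. Proof. by rewrite ler_wpDl. Qed.
Let n_gt0 k : 0 < n_ k. Proof. exact: lt_le_trans ltr01 (n_ge1 k). Qed.

Let fastE k : fast_step k = alpha * n_ k `^ (- (1 / 2 + 66 / 100 * eps)).
Proof. by rewrite powRN. Qed.

Let slowE k : slow_step k = beta * n_ k `^ (- (3 / 4 + eps)).
Proof. by rewrite powRN. Qed.

Let powD k a b : n_ k `^ a * n_ k `^ b = n_ k `^ (a + b).
Proof. by rewrite powRD// (gt_eqF (n_gt0 k)) implybT. Qed.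

Let pow1 k : n_ k `^ 1 = n_ k.
Proof. exact: powRr1 (ltW (n_gt0 k)). Qed.

Let powN1 k : (n_ k)^-1 = n_ k `^ (- 1).
Proof. by rewrite powR_inv1 // ltW. Qed.

(** A common bound for the five constants met in the comparisons below. *)
Definition rate_const := alpha + beta / alpha + beta^-1 + beta + beta ^+ 2.

Let const_terms : [/\ 0 <= alpha, 0 <= beta / alpha, 0 <= beta^-1, 0 <= beta &
  0 <= beta ^+ 2].
Proof. by split; rewrite ?ltW// ?divr_gt0 ?invr_gt0 ?exprn_gt0. Qed.

Lemma rate_const_gt0 : 0 < rate_const.
Proof. by have [? ? ? ? ?] := const_terms; rewrite /rate_const !ltr_wpDr. Qed.

Let const_ge : [/\ alpha <= rate_const, beta / alpha <= rate_const,
  beta^-1 <= rate_const, beta <= rate_const & beta ^+ 2 <= rate_const].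
Proof.
have [+ + + + +] := const_terms; rewrite /rate_const.
by move: (beta / alpha) beta^-1 (beta ^+ 2) => p q s *; split; lra.
Qed.

Lemma fast_step_bnd k : 0 < fast_step k <= alpha.
Proof.
rewrite fastE mulr_gt0 ?powR_gt0//= -[leRHS]mulr1 ler_pM2l//.
rewrite -[leRHS](powRr0 (n_ k)) ler_powR//; move: eps0 eps14; lra.
Qed.

Lemma slow_step_gt0 k : 0 < slow_step k.
Proof. by rewrite slowE mulr_gt0 ?powR_gt0. Qed.

(** The decay exponents are 3/2 + 2 eps and 3/2 + 1.98 eps: the factor 0.66 is just below the
    critical 2/3. *)
Lemma slow_fast_cube k : slow_step k ^+ 2 <= beta ^+ 2 / alpha ^+ 3 * fast_step k ^+ 3.
Proof.
rewrite slowE fastE !exprMn [leRHS]mulrA divfK ?gt_eqF ?exprn_gt0//.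
rewrite ler_pM2l ?exprn_gt0// !exprS expr0 !mulr1 !powD ler_powR//; move: eps0 eps14; lra.
Qed.

Lemma slow_le_fast k : slow_step k <= rate_const * fast_step k.
Proof.
have [? ? ? ? ?] := const_ge.
apply: (@le_trans _ _ (beta / alpha * fast_step k)).
  rewrite slowE fastE [leRHS]mulrA divfK ?gt_eqF// ler_pM2l// ler_powR//; move: eps0 eps14; lra.
rewrite ler_pM2r; last by have /andP[] := fast_step_bnd k.
by [].
Qed.

Lemma fast_le_sqrt k : fast_step k <= rate_const * n_ k `^ (- (1 / 2)).
Proof.
have [? ? ? ? ?] := const_ge.
rewrite fastE; apply: ler_pM => //; rewrite ?powR_ge0 ?sqr_ge0 ?(ltW al0) ?(ltW be0)//.
by rewrite ler_powR//; move: eps0 eps14; lra.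
Qed.

Lemma fast_step_large c : exists k0, forall k, (k0 <= k)%N -> c <= fast_step k * n_ k.
Proof.
have r0 : 0 < 1 - (1 / 2 + 66 / 100 * eps) by move: eps0 eps14; lra.
have c0 : 0 < alpha / (`|c| + 1) by rewrite divr_gt0// ltr_wpDl.
have [k0 h] := powR_shift_small K11 r0 c0; exists k0 => k kk.
have -> : fast_step k * n_ k = alpha * n_ k `^ (1 - (1 / 2 + 66 / 100 * eps)).
  by rewrite fastE -[LHS]mulrA -[X in alpha * (_ * X)]pow1 powD; congr (_ * _ `^ _); lra.
have := h k kk; rewrite powRN ler_pdivlMr ?ltr_wpDl// mulrC.
rewrite ler_pdivrMr ?powR_gt0// => hc.
by rewrite (le_trans _ hc)// (le_trans (ler_norm _))// lerDl.
Qed.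

Lemma slow_step_large k : n_ k `^ (1 / 4 - eps) <= rate_const * (slow_step k * n_ k).
Proof.
have [? ? ? ? ?] := const_ge.
have -> : slow_step k * n_ k = beta * n_ k `^ (1 / 4 - eps).
  rewrite slowE -[LHS]mulrA -[X in beta * (_ * X)]pow1 powD.
  by congr (_ * _ `^ _); lra.
rewrite mulrA ler_peMl ?powR_ge0//.
by rewrite -ler_pdivrMr// div1r.
Qed.

Lemma slow_step_small k : slow_step k * n_ k `^ (- (1 / 2)) <=
  rate_const * ((n_ k)^-1 * n_ k `^ (- (1 / 4 - eps))).
Proof.
have [? ? ? ? ?] := const_ge.
rewrite slowE -[leLHS]mulrA powN1 !powD.
apply: ler_pM => //; rewrite ?powR_ge0 ?(ltW be0)//.
by rewrite ler_powR//; move: eps0 eps14; lra.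
Qed.

Lemma slow_step_sq_small k : slow_step k ^+ 2 <=
  rate_const * ((n_ k)^-1 * n_ k `^ (- (1 / 4 - eps))).
Proof.
have [? ? ? ? ?] := const_ge.
rewrite slowE exprMn powN1 powD expr2 [X in _ * X]expr2 powD -expr2.
apply: ler_pM => //; rewrite ?powR_ge0 ?sqr_ge0 ?(ltW al0) ?(ltW be0)//.
by rewrite ler_powR//; move: eps0 eps14; lra.
Qed.

Lemma fast_discount G : 0 <= G -> exists U : nat -> R, exists k0,
  [/\ forall k, 0 <= U k,
    forall c, 0 < c -> exists k1, forall k, (k1 <= k)%N -> U k <= c &
    forall k, (k0 <= k)%N -> (1 + U k.+1) * (1 + G * fast_step k ^+ 2) <= 1 + U k].
Proof.
move=> G0; have d01 : 0 < 132 / 100 * eps <= 1 by apply/andP; split; move: eps0 eps14; lra.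
have [U [k0 [U0 Uc hU]]] := discount K11 d01 (mulr_ge0 G0 (sqr_ge0 alpha)).
exists U, k0; split => // k kk.
suff -> : G * fast_step k ^+ 2 = G * alpha ^+ 2 * n_ k `^ (- (1 + 132 / 100 * eps)).
  exact: hU.
rewrite fastE exprMn mulrA [X in _ * X]expr2 powD; congr (_ * _ `^ _); move: eps0 eps14; lra.
Qed.

End StepSizes.

Theorem corollary5p7 (R : realType) (d : measure_display)
    (T : measurableType d) (P : probability T R)
    (d1 d2 m : nat) (rho L : R)
    (H0 : 'cV[R]_d1 -> R) (H : 'I_m -> 'cV[R]_d1 -> R)
    (A : 'M[R]_(d2, d1)) (b0 : 'cV[R]_d2)
    (c2 eps alpha beta K1 : R)
    (x0 : 'cV[R]_d1) (lambda0 : 'cV[R]_d2)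
    (M : nat -> T -> 'cV[R]_d1)
    (x : nat -> T -> 'cV[R]_d1) (lambda : nat -> T -> 'cV[R]_d2) :
  0 < rho -> 0 < L ->
  strongly_concave rho H0 -> smooth L H0 ->
  (forall i, continuously_differentiable (H i)) ->
  (forall i, convex_function setT (H i)) ->
  (exists z, (forall i, H i z < 0) /\ A *m z = b0) ->
  0 < eps < 1 / 4 ->
  0 < alpha -> 0 < beta -> 1 <= K1 ->
  (forall w, x 0%N w = x0) ->
  (forall w, lambda 0%N w = lambda0) ->
  (forall k w, x k.+1 w =
     proj (sublevel H)
       (x k w + (alpha / (k%:R + K1) `^ (1 / 2 + 66 / 100 * eps)) *:
          (grad H0 (x k w) - A^T *m lambda k w + M k.+1 w))) ->
  (forall k w, lambda k.+1 w =
     lambda k w + (beta / (k%:R + K1) `^ (3 / 4 + eps)) *: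
       (A *m x k w - b0)) ->
  0 < c2 -> martingale_noise P c2 M x lambda ->
  [/\ {ae P, forall w,
        enorm (x k w - xhat (sublevel H) H0 A (lambda k w)) @[k --> \oo]
          --> (0 : R)},
      {ae P, forall w, A *m x k w @[k --> \oo] --> b0},
      exists C : R, forall k : nat, (0 < k)%N ->
        ('E_P[(fun w =>
            enorm (x k w - xhat (sublevel H) H0 A (lambda k w)) ^+ 2)%R]
          <= (C / k%:R `^ (1 / 2))%:E)%E &
      exists C : R, forall k : nat, (0 < k)%N ->
        ('E_P[(fun w => enorm (A *m x k w - b0) ^+ 2)%R]
          <= (C / k%:R `^ (1 / 4 - eps))%:E)%E].
Proof.
move=> rho0 L0 scH smH cdH cvH [z [zH Az]] /andP[eps0 eps14] al0 be0 K11 x0E l0E xS lS c20 MN.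
have [dH lipH] := smH.
have sH := supergradient_grad dH scH.
have L20 : 0 <= L ^+ 2 := sqr_ge0 _.
(* Lipschitz bounds are kept between squared norms, so the constant is squared. *)
have lH : lipschitz_sq (L ^+ 2) (grad H0).
  move=> u v; rewrite -!enorm_sq -exprMn ler_pXn2r ?nnegrE ?enorm_ge0//.
  by rewrite mulr_ge0 ?enorm_ge0// ltW.
have cH0 : continuous H0 by move=> u; exact: differentiable_continuous.
have cH i : continuous (H i) by move=> u; apply: differentiable_continuous; have [h _] := cdH i.
have cX := convex_sublevel cvH; have clX := closed_sublevel cH.
have zX : sublevel H z by move=> i; exact: ltW.
have X0 : sublevel H !=set0 by exists z.
have [delta delta0 hdelta] := sublevel_interior cH zH.
have xh_in l : sublevel H (xhat (sublevel H) H0 A l).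
  exact: (xhat_in A rho0 sH L20 cX clX X0 lH cH0).
have xh_VI l y : sublevel H y -> dot (grad H0 (xhat (sublevel H) H0 A l) - A^T *m l)
    (y - xhat (sublevel H) H0 A l) <= 0.
  by move=> Xy; exact: (xhat_VI A rho0 sH L20 cX clX X0 lH cH0 l Xy).
have xh_ker l l' : A^T *m l = A^T *m l' ->
  xhat (sublevel H) H0 A l = xhat (sublevel H) H0 A l'.
  by move=> E; rewrite /xhat E.
(* From here only feasibility, the variational inequality and dependence through [A^T l] are known
   of [xhat]. *)
move: xh_in xh_VI xh_ker; set xh := xhat _ _ _; clearbody xh => xh_in xh_VI xh_ker.
have [ls lsmin] := dual_minimizer rho0 sH xh_in xh_VI L20 lH delta0 hdelta Az xh_ker.
have r0 : 0 < 1 / 4 - eps by lra.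
have r14 : 1 / 4 - eps <= 1 / 4 by lra.
(* Removes the shift [K1] from the rates; [k] must be positive for the unshifted power to be
   invertible. *)
have neg_pow (B r : R) k : 0 <= B -> 0 <= r -> (0 < k)%N ->
    (B * (k%:R + K1) `^ (- r) <= B / k%:R `^ r)%R.
  move=> B0 r0' k0; rewrite powRN ler_wpM2l// lef_pV2 ?posrE ?powR_gt0 ?ltr0n//.
    have K10 : 0 <= K1 := le_trans ler01 K11.
    by apply: (ge0_ler_powR r0'); rewrite ?nnegrE ?addr_ge0 ?lerDl.
  by rewrite ltr_wpDl// (lt_le_trans ltr01).
split.
- refine (err_as_cvg0 rho0 sH L20 lH cX clX xh_in xh_VI lsmin
  (fast_step_bnd eps0 eps14 al0 K11) (slow_step_gt0 eps be0 K11)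
  (slow_fast_cube eps0 eps14 al0 be0 K11) x0E l0E xS lS c20 MN K11 r0 r14
  (rate_const_gt0 al0 be0) (@fast_discount _ _ alpha _ eps0 eps14 K11)
  (slow_le_fast eps0 eps14 al0 be0 K11) (fast_le_sqrt eps0 eps14 al0 be0 K11)
  (fast_step_large eps0 eps14 al0 K11) (slow_step_large eps al0 be0 K11)
  (slow_step_small eps0 eps14 al0 be0 K11) (slow_step_sq_small eps0 eps14 al0 be0 K11)).
- refine (constraint_as_cvg rho0 sH L20 lH cX clX xh_in xh_VI lsmin
  (fast_step_bnd eps0 eps14 al0 K11) (slow_step_gt0 eps be0 K11)
  (slow_fast_cube eps0 eps14 al0 be0 K11) x0E l0E xS lS c20 MN K11 r0 r14
  (rate_const_gt0 al0 be0) (@fast_discount _ _ alpha _ eps0 eps14 K11)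
  (slow_le_fast eps0 eps14 al0 be0 K11) (fast_le_sqrt eps0 eps14 al0 be0 K11)
  (fast_step_large eps0 eps14 al0 K11) (slow_step_large eps al0 be0 K11)
  (slow_step_small eps0 eps14 al0 be0 K11) (slow_step_sq_small eps0 eps14 al0 be0 K11)).
- have [B B0 hB] := err_mean_rate rho0 sH L20 lH cX clX xh_in xh_VI lsmin
  (fast_step_bnd eps0 eps14 al0 K11) (slow_step_gt0 eps be0 K11)
  (slow_fast_cube eps0 eps14 al0 be0 K11) x0E l0E xS lS c20 MN K11
  (rate_const_gt0 al0 be0) (@fast_discount _ _ alpha _ eps0 eps14 K11)
  (fast_le_sqrt eps0 eps14 al0 be0 K11)
  (fast_step_large eps0 eps14 al0 K11).
  by exists B => k k0; rewrite (le_trans (hB k))// lee_fin neg_pow.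
- have [B B0 hB] := constraint_mean_rate rho0 sH L20 lH cX clX xh_in xh_VI lsmin
  (fast_step_bnd eps0 eps14 al0 K11) (slow_step_gt0 eps be0 K11)
  (slow_fast_cube eps0 eps14 al0 be0 K11) x0E l0E xS lS c20 MN K11 r0 r14
  (rate_const_gt0 al0 be0) (@fast_discount _ _ alpha _ eps0 eps14 K11)
  (fast_le_sqrt eps0 eps14 al0 be0 K11)
  (fast_step_large eps0 eps14 al0 K11) (slow_step_large eps al0 be0 K11)
  (slow_step_small eps0 eps14 al0 be0 K11) (slow_step_sq_small eps0 eps14 al0 be0 K11).
  by exists B => k k0; rewrite (le_trans (hB k))// lee_fin neg_pow// ltW.
Qed.
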